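(* Fix $\eta\in(0,1)$. There exist constants $C,c>0$ depending only on $\eta$ and, for each $\varepsilon>0$, a constant $C(\varepsilon)$ depending only on $\varepsilon$ and $\eta$, such that the following holds. Let $(K,d)$ be a compact metric space of diameter at most $1$, and suppose that for each $\delta>0$, $N(\delta)$ is a number such that $K$ may be covered by $N(\delta)$ open $d$-balls of radius $\delta$. Let $x_1,\dots,x_n\in K$, let $M$ be the $n\times n$ distance matrix whose $(i,j)$th entry is $d(x_i,x_j)$, and let $p\in[0,1]$ satisfy $p\ge n^{-1+\varepsilon}$ for some $\varepsilon>0$. Then the USVT estimator $\hat M$ with tuning parameter $\eta$ satisfies $$\operatorname{MSE}(\hat M)\le C\inf_{\delta>0}\min\left\{\frac{\delta+\sqrt{N(\delta/4)/n}}{\sqrt p},\ 1\right\}+C(\varepsilon)e^{-cnp}.$$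
   Context: The data come from a data matrix $X$ with mean $M$ under either of the following models (order $n\times n$). Asymmetric model (with $m=n$): $X$ is a random $n\times n$ matrix with independent entries, $\mathbb{E}(x_{ij})=m_{ij}$ and $|x_{ij}|\le 1$ almost surely ($X=M$ allowed); each entry of $X$ is observed with probability $p$ and unobserved with probability $1-p$, independently of everything else. Symmetric model: $X$ is symmetric, its entries on and above the diagonal are independent with $\mathbb{E}(x_{ij})=m_{ij}$ and $|x_{ij}|\le1$ almost surely; each entry on and above the diagonal is observed with probability $p$, independently of everything else, and for $i<j$ the entry $(j,i)$ is observed if and only if $(i,j)$ is. $\operatorname{MSE}(\hat M):=\mathbb{E}\big[\frac1{n^2}\sum_{i,j=1}^n(\hat m_{ij}-m_{ij})^2\big]$. USVT estimator with tuning parameter $\eta\in(0,1)$: let $y_{ij}=x_{ij}$ if $x_{ij}$ is observed and $y_{ij}=0$ otherwise, $Y=(y_{ij})$, with singular value decomposition $Y=\sum_{i=1}^n s_iu_iv_i^T$. Let $\hat p$ be the proportion of observed entries of $X$ (in the symmetric model: among those on and above the diagonal). Let $S:=\{i: s_i\ge(2+\eta)\sqrt{n\hat p}\}$ and $W:=\frac1{\hat p}\sum_{i\in S}s_iu_iv_i^T$ (if $\hat p=0$, put $W:=0$). Finally $\hat m_{ij}$ is the truncation of $w_{ij}$ to $[-1,1]$ ($\hat m_{ij}=w_{ij}$ if $|w_{ij}|\le1$, $1$ if $w_{ij}>1$, $-1$ if $w_{ij}<-1$). *)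

(* Defs.v *)
From HB Require Import structures.
From mathcomp Require Import all_boot all_order all_algebra.
From mathcomp Require Import all_classical all_reals all_analysis.

Set Implicit Arguments.
Unset Strict Implicit.
Unset Printing Implicit Defensive.

Import Order.TTheory GRing.Theory Num.Theory.
Import numFieldNormedType.Exports.

Local Open Scope classical_set_scope.
Local Open Scope ring_scope.

(* Mutual independence, under P, of the families of events G i with i in D. *)
Definition mutually_independent d (T : measurableType d) (R : realType)
    (P : probability T R) (I : finType) (D : pred I) (G : I -> set_system T) :=
  forall (J : {set I}) (A : I -> set T),
    (forall i, i \in J -> D i /\ G i (A i)) ->
    P (\bigcap_(i in [set i | i \in J]) A i) = (\prod_(i in J) P (A i))%E.

Definition sigma_of d d' (T : measurableType d) (T' : measurableType d')
    (f : T -> T') : set_system T :=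
  preimage_set_system [set: T] f measurable.

Inductive sampling_model := Asymmetric | Symmetric.

(* The positions carrying independent data: all of them in the asymmetric
   model, those on and above the diagonal in the symmetric one. *)
Definition free_entries (m : sampling_model) (n : nat) : pred ('I_n * 'I_n) :=
  fun ij => if m is Symmetric then (ij.1 <= ij.2)%N else true.

(* X i j is the (i, j) entry of the data matrix and O i j the indicator that
   it is observed.  The sum type indexes the joint family of all the x_ij
   (inl) and all the observation indicators (inr). *)
Record data_model d (T : measurableType d) (R : realType)
    (P : probability T R) (m : sampling_model) (n : nat) (M : 'M[R]_n) (p : R)
    (X : 'I_n -> 'I_n -> {RV P >-> R})
    (O : 'I_n -> 'I_n -> {RV P >-> bool}) : Prop := DataModel {
  data_mean : forall i j, ('E_P[X i j] = (M i j)%:E)%E ;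
  data_bounded : forall i j, {ae P, forall w, `|X i j w| <= 1} ;
  data_observed : forall i j, P [set w | O i j w = true] = p%:E ;
  data_symmetric : m = Symmetric -> forall i j w, X i j w = X j i w ;
  observed_symmetric : m = Symmetric -> forall i j w, O i j w = O j i w ;
  data_independent :
    mutually_independent P
      (fun k : ('I_n * 'I_n) + ('I_n * 'I_n) =>
         match k with inl ij | inr ij => free_entries m ij end)
      (fun k => match k with
                | inl ij => sigma_of (X ij.1 ij.2)
                | inr ij => sigma_of (O ij.1 ij.2)
                end) }.

Section usvt.
Context {R : realType} {n : nat}.

Definition orthonormal_family (u : 'I_n -> 'cV[R]_n) :=
  forall i j, (u i)^T *m u j = ((i == j)%:R)%:M.

Definition is_svd (Y : 'M[R]_n) (s : 'I_n -> R) (u v : 'I_n -> 'cV[R]_n) :=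
  [/\ forall i, 0 <= s i,
      orthonormal_family u,
      orthonormal_family v &
      Y = \sum_i s i *: (u i *m (v i)^T)].

Definition observed_matrix (x : 'I_n -> 'I_n -> R) (o : 'I_n -> 'I_n -> bool) :
    'M[R]_n :=
  \matrix_(i, j) (if o i j then x i j else 0).

Definition observed_proportion (m : sampling_model)
    (o : 'I_n -> 'I_n -> bool) : R :=
  #|[pred ij | free_entries m ij && o ij.1 ij.2]|%:R
  / #|free_entries m (n := n)|%:R.

Definition usvt_threshold (eta phat : R) (s : 'I_n -> R)
    (u v : 'I_n -> 'cV[R]_n) : 'M[R]_n :=
  if phat == 0 then 0
  else phat^-1 *: \sum_(i | (2 + eta) * Num.sqrt (n%:R * phat) <= s i)
                    s i *: (u i *m (v i)^T).

Definition truncate (w : R) : R :=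
  if 1 < w then 1 else if w < -1 then -1 else w.

(* A is the USVT estimate computed from the data x with observation pattern o.
   It is stated as a relation because the singular value decomposition is not
   unique; A itself does not depend on the decomposition, since the rank-one
   terms of equal singular values are kept or discarded together. *)
Definition is_usvt (m : sampling_model) (eta : R) (x : 'I_n -> 'I_n -> R)
    (o : 'I_n -> 'I_n -> bool) (A : 'M[R]_n) : Prop :=
  exists s : 'I_n -> R, exists u v : 'I_n -> 'cV[R]_n,
    is_svd (observed_matrix x o) s u v /\
    A = map_mx truncate (usvt_threshold eta (observed_proportion m o) s u v).

End usvt.

Definition MSE d (T : measurableType d) (R : realType) (P : probability T R)
    (n : nat) (Mhat : T -> 'M[R]_n) (M : 'M[R]_n) : \bar R :=
  ('E_P[fun w => (n%:R ^+ 2)^-1 *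
                 \sum_(i < n) \sum_(j < n) (Mhat w i j - M i j) ^+ 2]%R)%E.

Definition distance_matrix (R : realType) (K : metricType R) (n : nat)
    (x : 'I_n -> K) : 'M[R]_n :=
  \matrix_(i, j) mdist (x i) (x j).

Definition covered_by_balls (R : realType) (K : metricType R) (k : nat)
    (delta : R) : Prop :=
  exists z : 'I_k -> K, [set: K] `<=` \bigcup_i ball (z i) delta.

(* Main.v *)
(** High moments of the noise Y - p M are computed by expanding the trace of a
    power over closed walks.  A step costs sqrt(np) when it discovers a vertex or
    closes an open edge, and only a power of k when it revisits a vertex, so the
    moment of order 2k is at most 2n (2 sqrt(np) + O(k^2))^(2k).  Taking k of order
    log n, and using np >= n^eps, the operator norm of the noise is at most
    (2 + eta/2) sqrt(np) outside an event of probability O(1/n); by Chebyshev the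
    observed proportion is p (1 + O(n^(-1/2))) outside an event of probability
    O(1/(np)).  On the good event the thresholded matrix is compared with p M Q,
    where Q averages the columns over the points lying in a common ball of radius
    delta/4: Q is a projection of rank at most N = N(delta/4) which moves the
    entries of M by at most delta/2, and the error is O(N/(np) + delta^2).  As
    N >= 1, the probability of the bad event is of the same order as the main term;
    the exponential term is only needed when n is bounded in terms of eps. *)

Require Import Defs.
From HB Require Import structures.
From mathcomp Require Import all_boot all_order all_algebra.
From mathcomp Require Import zify ring lra.

Set Implicit Arguments.
Unset Strict Implicit.
Unset Printing Implicit Defensive.

Import Order.TTheory GRing.Theory Num.Theory.

Local Open Scope ring_scope.

(** * Closed walks *)

(** The threshold [2 + eta] leaves no room for a larger constant in the noise bound when [eta] is
    small, so the 2 must come out exactly. It is the sum of two equal costs: discovering a vertex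
    and closing an open edge each cost [s], where s^2 bounds the variance of a row. To split the
    cost evenly, the whole variance of an edge is paid at its discovery, and a factor 1/s is held
    for each open edge and given back when it closes. Walks are not classified by shape: a potential
    on the states of the walk absorbs every step. The choice among several open edges, which would
    spoil the count, is charged to the integer [excess], which can grow only at revisits. The order
    k must be at least of order log n, since otherwise a power 2k does not beat the factor 2n in the
    trace, while k^2 must stay small against sqrt(np); this is why np has to grow polynomially. The
    distance from noise level 2 + eta/2 to threshold 2 + eta pays for the error of the observed
    proportion and for the cross term between noise and approximation error. *)

Section WalkSum.
Variables (R : realFieldType) (I E : finType) (edge : I -> I -> option E).
Variable mom : E -> nat -> R.

Definition incr_at (e : E) (m : E -> nat) : E -> nat := fun f => ((f == e) + m f)%N.
Arguments incr_at : simpl never.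

(** The expectation along a walk does not factor step by step, because edges recur. Hence the
    accumulator [m]: moments are evaluated only when the walk has ended, at the total
    multiplicities. Loops are allowed, and [None] stands for a zero entry. *)
Fixpoint walk_sum (a : I) (t : nat) (m : E -> nat) (c : I) : R :=
  if t is t'.+1 then
    \sum_j (if edge c j is Some e then walk_sum a t' (incr_at e m) j else 0)
  else (c == a)%:R * \prod_e mom e (m e).

Hypothesis edge_sym : forall i j, edge i j = edge j i.
Hypothesis edge_inj : forall i j k l e, edge i j = Some e -> edge k l = Some e ->
  (i = k /\ j = l) \/ (i = l /\ j = k).

Variables (v : E -> R) (B s : R).
Hypotheses (v_ge0 : forall e, 0 <= v e) (B_ge0 : 0 <= B) (s_gt0 : 0 < s).
Hypothesis mom1 : forall e, mom e 1 = 0.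
Hypothesis mom_le : forall e k, `|mom e k| <= B ^+ k.
Hypothesis mom_ge2_le : forall e k, (2 <= k)%N -> `|mom e k| <= v e * B ^+ (k - 2).
Hypothesis row_var_le : forall c,
  \sum_j (if edge c j is Some e then v e else 0) <= s ^+ 2.

(* A state of the walk is its set of visited vertices, the set of edges by which
   a vertex was first reached, the multiplicities and the current vertex.  An
   edge is open when it must still be traversed again for the moment not to
   vanish. *)
Definition open_edges (tree : {set E}) (m : E -> nat) : {set E} :=
  [set e in tree | m e == 1%N].

Definition joined_by (op : {set E}) (i j : I) : bool :=
  if edge i j is Some e then e \in op else false.

Definition open_deg (op : {set E}) (i : I) : nat := #|[set j | joined_by op i j]|.

(* The excess counts the choices that the walk still has when it closes edges:
   along a plain depth-first walk it is zero, and closing one of several open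
   edges decreases it. *)
Definition excess (op : {set E}) (c : I) : nat :=
  (\sum_i (open_deg op i - (if i == c then 1 else 2)))%N.

(** The variance of a tree edge is charged at its discovery: by truncated subtraction [m e - 2] is 0
    at multiplicity 1 as well as 2, so the second traversal is free. Every other traversal costs
    [B]. *)
Definition state_weight (tree : {set E}) (m : E -> nat) : R :=
  \prod_e (if e \in tree then v e * B ^+ (m e - 2) else B ^+ (m e)).

Lemma state_weight_ge0 (tree : {set E}) (m : E -> nat)  : 0 <= state_weight tree m.
Proof.
by apply: prodr_ge0 => e _; case: ifP => _; rewrite ?mulr_ge0 ?exprn_ge0.
Qed.

Lemma incr_atE e m : incr_at e m e = (m e).+1.
Proof. by rewrite /incr_at eqxx. Qed.

Lemma incr_at_neq e m f : f != e -> incr_at e m f = m f.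
Proof. by rewrite /incr_at => /negbTE ->. Qed.

Lemma state_weight_new (tree : {set E}) (m : E -> nat) e : m e = 0%N -> e \notin tree ->
  state_weight (e |: tree) (incr_at e m) = v e * state_weight tree m.
Proof.
move=> me et; rewrite /state_weight (bigD1 e) //= [in RHS](bigD1 e) //=.
rewrite in_setU1 eqxx /= incr_atE me (negbTE et) expr0 mul1r mulr1; congr (_ * _).
by apply: eq_bigr => f fe; rewrite in_setU1 (negbTE fe) /= incr_at_neq.
Qed.

Lemma state_weight_incr (tree : {set E}) (m : E -> nat) e : (e \in tree -> 2 <= m e)%N ->
  state_weight tree (incr_at e m) = B * state_weight tree m.
Proof.
move=> et; rewrite /state_weight (bigD1 e) //= [in RHS](bigD1 e) //= mulrA.
rewrite incr_atE; congr (_ * _); last first.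
  by apply: eq_bigr => f fe; rewrite incr_at_neq.
case: ifP => [/et m2|_]; last by rewrite exprS.
by rewrite subSn // exprS mulrCA.
Qed.

Lemma state_weight_close (tree : {set E}) (m : E -> nat) e : e \in open_edges tree m ->
  state_weight tree (incr_at e m) = state_weight tree m.
Proof.
rewrite inE => /andP[et /eqP me]; rewrite /state_weight (bigD1 e) //=.
rewrite [in RHS](bigD1 e) //= incr_atE me et; congr (_ * _).
by apply: eq_bigr => f fe; rewrite incr_at_neq.
Qed.

Lemma excess_le (op op' : {set E}) (c c' : I) (k : nat) :
  (forall i, i != c -> open_deg op' i - (if i == c' then 1 else 2)
     <= open_deg op i - 2)%N ->
  (open_deg op' c - (if c == c' then 1 else 2) + k <= open_deg op c - 1)%N ->
  (excess op' c' + k <= excess op c)%N.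
Proof.
move=> h1 h2; rewrite /excess (bigD1 c) //= [X in (_ <= X)%N](bigD1 c) //= eqxx.
rewrite addnAC leq_add //; apply: leq_sum => i ic.
by rewrite (negbTE ic); apply: h1.
Qed.

Lemma open_new (tree : {set E}) (m : E -> nat) e : m e = 0%N ->
  open_edges (e |: tree) (incr_at e m) =
  e |: open_edges tree m.
Proof.
move=> me; apply/setP => f; rewrite !(in_set, in_set1) /incr_at; case: (eqVneq f e) => [->|fe] /=.
  by rewrite me.
by rewrite add0n.
Qed.

Lemma open_close (tree : {set E}) (m : E -> nat) e : e \in open_edges tree m ->
  open_edges tree (incr_at e m) = open_edges tree m :\ e.
Proof.
rewrite inE => /andP[et /eqP me]; apply/setP => f; rewrite !(in_set, in_set1) /incr_at.
case: (eqVneq f e) => [->|fe] /=; first by rewrite me et.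
by rewrite add0n.
Qed.

Lemma open_incr (tree : {set E}) (m : E -> nat) e : e \notin open_edges tree m -> (e \in tree ->
  m e != 0)%N ->
  open_edges tree (incr_at e m) = open_edges tree m.
Proof.
rewrite inE => eo e0; apply/setP => f; rewrite !(in_set, in_set1) /incr_at.
case: (eqVneq f e) => [->|fe] /=; last by rewrite add0n.
rewrite add1n; case: (boolP (e \in tree)) eo => //= et m1.
by rewrite (negbTE m1); case: (m e) (e0 et).
Qed.

Lemma open_deg_close (op : {set E}) i j e : edge i j = Some e -> e \in op ->
  (open_deg (op :\ e) i).+1 = open_deg op i.
Proof.
move=> ij eo; have jo : j \in [set k | joined_by op i k] by rewrite inE /joined_by ij.
rewrite /open_deg [in RHS](cardsD1 j) jo add1n; congr _.+1; apply: eq_card => k;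
  rewrite !inE /joined_by.
case ik: (edge i k) => [f|]; last by rewrite andbF.
rewrite !inE; case: (eqVneq k j) => [kj|kj] /=.
  by move: ik; rewrite kj ij => -[->]; rewrite eqxx.
case: (eqVneq f e) => //= fe; exfalso; move: kj; rewrite fe in ik.
by case: (edge_inj ij ik) => -[? ?]; subst; rewrite eqxx.
Qed.

Lemma open_degS (op op' : {set E}) i : op \subset op' ->
  (open_deg op i <= open_deg op' i)%N.
Proof.
move=> /subsetP so; apply: subset_leq_card; apply/subsetP => j; rewrite !inE.
by rewrite /joined_by; case: (edge i j) => // e; apply: so.
Qed.

Lemma open_deg_new_other (op : {set E}) i c j e : edge c j = Some e ->
  i != c -> i != j -> open_deg (e |: op) i = open_deg op i.
Proof.
move=> cj ic ij; rewrite /open_deg; apply: eq_card => k; rewrite !inE /joined_by.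
case ik: (edge i k) => [f|] //; rewrite !inE; case: eqVneq => //= fe; exfalso.
rewrite fe in ik; case: (edge_inj cj ik) => -[? ?]; subst.
  by rewrite eqxx in ic.
by rewrite eqxx in ij.
Qed.

Lemma open_deg_new_le (op : {set E}) i e :
  (open_deg (e |: op) i <= (open_deg op i).+1)%N.
Proof.
case: (boolP [exists j, edge i j == Some e]) => [/existsP[j /eqP ij]|ne].
  rewrite -(open_deg_close (op := e |: op) ij) ?setU11 // ltnS.
  by apply: open_degS; apply/subsetP => f; rewrite !inE => /andP[/negbTE ->].
apply: leqW; apply: subset_leq_card; apply/subsetP => j; rewrite !inE /joined_by.
case ij: (edge i j) => [f|] //; rewrite !inE => /orP[/eqP fe|//].
by exfalso; move/negP: ne; apply; apply/existsP; exists j; rewrite ij fe.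
Qed.

Variable L : nat.

Let growth : R := 2 * s + B * L%:R ^+ 2.

Lemma growth_ge0 : 0 <= growth.
Proof. by rewrite addr_ge0 ?mulr_ge0 ?exprn_ge0 // ltW. Qed.

(** The potential of a state. Each open edge holds a factor 1/s that its closing gives back, and the
    power of [L] prepays the choices among open edges. *)
Definition state_bound tree m c : R :=
  state_weight tree m * s ^- #|open_edges tree m| * L%:R ^+ excess (open_edges tree m) c.

Definition good_state (vis : {set I}) (tree : {set E}) (m : E -> nat) : Prop :=
  (forall i j e, edge i j = Some e -> m e != 0%N -> i \in vis) /\
  (forall e, e \in tree -> m e != 0%N).

Lemma open_deg_vis (vis : {set I}) (tree : {set E}) (m : E -> nat) i : good_state vis tree m ->
  (open_deg (open_edges tree m) i <= #|vis|)%N.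
Proof.
case=> g1 g2; apply: subset_leq_card; apply/subsetP => j; rewrite inE /joined_by.
case ij: (edge i j) => [e|] // /[!inE] /andP[et _].
by apply: (g1 _ i e); rewrite 1?edge_sym // g2.
Qed.

Lemma open_deg_notin (vis : {set I}) (tree : {set E}) (m : E ->
  nat) i : good_state vis tree m -> i \notin vis ->
  open_deg (open_edges tree m) i = 0%N.
Proof.
case=> g1 g2 iv; apply/eqP; rewrite cards_eq0; apply/eqP/setP => j.
rewrite !inE /joined_by; case ij: (edge i j) => [e|] //.
apply/negbTE; apply: contra iv; rewrite inE => /andP[et _].
by apply: (g1 i j e); rewrite // g2.
Qed.

(** The excess does not grow: the new vertex gets open degree at most 1, which a current vertex may
    have, and the vertex left behind gains one open edge while its allowance rises from 1 to 2.
    Summed over [j], the cost is at most s^2 / s = s. *)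
Lemma new_vertex_bound (vis : {set I}) (tree : {set E}) (m : E -> nat) c j e : (0 < L)%N ->
  good_state vis tree m -> c \in vis -> j \notin vis -> edge c j = Some e ->
  good_state (j |: vis) (e |: tree) (incr_at e m) /\
  state_bound (e |: tree) (incr_at e m) j <= state_bound tree m c * (v e / s).
Proof.
move=> L0 g cv jv cj; have [g1 g2] := g.
have me : m e = 0%N.
  apply/eqP; apply: contraNT jv => m0.
  by apply: (g1 j c e) => //; rewrite edge_sym.
have et : e \notin tree by apply/negP => /g2; rewrite me.
have jc : j != c by apply: contraNneq jv => ->.
split.
  split=> [i k f ik|f]; last first.
    rewrite in_setU1; case: (eqVneq f e) => [->|fe /= ft]; first by rewrite incr_atE.
    by rewrite incr_at_neq // g2.
  rewrite in_setU1; case: (eqVneq f e) => [fe _|fe]; last first.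
    by rewrite incr_at_neq // => mf; rewrite (g1 i k f) ?orbT.
  rewrite fe in ik; case: (edge_inj cj ik) => -[? ?]; subst; last by rewrite eqxx.
  by rewrite cv orbT.
rewrite /state_bound open_new // cardsU1 !inE (negbTE et) /= add1n.
rewrite state_weight_new //.
set op := open_edges tree m; set G := state_weight _ _.
have G0 : 0 <= G by apply: state_weight_ge0.
have ex : (excess (e |: op) j <= excess op c)%N.
  rewrite -[X in (X <= _)%N]addn0; apply: excess_le => [i ic|].
    case: eqVneq => [->|ij]; last by rewrite (open_deg_new_other _ cj).
    by have := open_deg_new_le op j e; rewrite (open_deg_notin g jv) // leq_subLR => /leq_trans;
      apply.
  rewrite eq_sym (negbTE jc) addn0.
  by have := open_deg_new_le op c e; lia.
rewrite exprS invfM.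
have -> : v e * G * (s^-1 * s ^- #|op|) * L%:R ^+ excess (e |: op) j =
  (v e * G * (s^-1 * s ^- #|op|)) * L%:R ^+ excess (e |: op) j by [].
have -> : G * s ^- #|op| * L%:R ^+ excess op c * (v e / s) =
  (v e * G * (s^-1 * s ^- #|op|)) * L%:R ^+ excess op c by ring.
apply: ler_wpM2l; last by apply: ler_weXn2l => //; rewrite ler1n.
by rewrite !mulr_ge0 // ?invr_ge0 ?exprn_ge0 // ltW.
Qed.

(** If several open edges meet at [c], leaving along one of them lowers the excess, and the factor
    [L] so released pays for the number of choices, which is at most [#|vis|]. A single open edge
    leaves no choice. Summed over the open edges at [c], the cost is [s]. *)
Lemma close_edge_bound (vis : {set I}) (tree : {set E}) (m : E -> nat) c j e : (#|vis| <= L)%N ->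
  good_state vis tree m -> c \in vis -> edge c j = Some e -> e \in open_edges tree m ->
  [/\ j \in vis, good_state vis tree (incr_at e m) &
  state_bound tree (incr_at e m) j <=
    state_bound tree m c * (s / (open_deg (open_edges tree m) c)%:R)].
Proof.
move=> vL g cv cj eo; have [g1 g2] := g.
have [et me] : e \in tree /\ m e = 1%N by move: eo; rewrite inE => /andP[-> /eqP ->].
split.
- by apply: (g1 j c e); rewrite 1?edge_sym ?me.
- split=> [i k f ik mf|f ft]; last by rewrite /incr_at addn_eq0 negb_and g2 ?orbT.
  apply: (g1 i k f) => //; move: mf; rewrite /incr_at; case: (eqVneq f e) => [->|//].
  by rewrite me.
rewrite /state_bound open_close // state_weight_close //.
set op := open_edges tree m in eo *; set G := state_weight _ _.
have G0 : 0 <= G by apply: state_weight_ge0.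
have dc : (open_deg (op :\ e) c).+1 = open_deg op c by apply: open_deg_close cj eo.
have dL : (open_deg op c <= L)%N by apply: leq_trans (open_deg_vis c g) vL.
have co : #|op| = #|op :\ e|.+1 by rewrite (cardsD1 e) eo.
rewrite co; set g0 := open_deg op c in dc dL *.
have ex : (excess (op :\ e) j + (1 < g0) <= excess op c)%N.
  apply: excess_le => [i ic|].
    case: (eqVneq i j) => [->|ij].
      by rewrite -(open_deg_close (i := j) (j := c) _ eo) 1?edge_sym //; lia.
    by apply: leq_sub2r; apply: open_degS; apply: subsetDl.
  rewrite -/g0 -dc; case: eqP => _; case: (open_deg _ c) => [|[|k]] //=; lia.
have g0L : g0%:R * L%:R ^+ excess (op :\ e) j <= L%:R ^+ excess op c :> R.
  have L1 : 1 <= L%:R :> R by rewrite ler1n; lia.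
  apply: le_trans (_ : L%:R ^+ (excess (op :\ e) j + (1 < g0)) <= _); last first.
    by apply: ler_weXn2l.
  rewrite exprD mulrC; apply: ler_wpM2l; first by rewrite exprn_ge0.
  case: (ltnP 1 g0) => g1' /=; first by rewrite expr1 ler_nat.
  by rewrite expr0 lern1.
have g0p : 0 < g0%:R :> R by rewrite ltr0n -dc.
have -> : G * s ^- #|op :\ e|.+1 * L%:R ^+ excess op c * (s / g0%:R) =
   (G * s ^- #|op :\ e|) * (L%:R ^+ excess op c / g0%:R).
  by rewrite exprS invfM; field; rewrite ?expf_neq0 // ?gt_eqF.
apply: ler_wpM2l; first by rewrite mulr_ge0 // invr_ge0 exprn_ge0 // ltW.
by rewrite ler_pdivlMr // mulrC.
Qed.

(** The open edges stay the same, but [j] becomes current and its allowance drops from 2 to 1, so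
    the excess grows by at most one; this is the factor [L]. As there are at most [L] visited
    targets, such steps cost B L^2 together. *)
Lemma revisit_bound (vis : {set I}) (tree : {set E}) (m : E -> nat) c j e : (0 < L)%N ->
  good_state vis tree m -> c \in vis -> j \in vis -> edge c j = Some e ->
  e \notin open_edges tree m ->
  good_state vis tree (incr_at e m) /\
  state_bound tree (incr_at e m) j <= state_bound tree m c * (B * L%:R).
Proof.
move=> L0 g cv jv cj eo; have [g1 g2] := g.
split.
  split=> [i k f ik mf|f ft]; last by rewrite /incr_at addn_eq0 negb_and g2 ?orbT.
  case: (eqVneq f e) => [fe|fe]; last first.
    by apply: (g1 i k f) => //; move: mf; rewrite incr_at_neq.
  by rewrite fe in ik; case: (edge_inj cj ik) => -[? ?]; subst.
rewrite /state_bound open_incr //; last by move=> /g2.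
rewrite state_weight_incr; last first.
  by move=> et; have := g2 _ et; move: eo; rewrite inE et /=; case: (m e) => [|[]].
set op := open_edges tree m in eo *; set G := state_weight _ _.
have G0 : 0 <= G by apply: state_weight_ge0.
have ex : (excess op j <= (excess op c).+1)%N.
  rewrite /excess (bigD1 j) //= [X in (_ <= X.+1)%N](bigD1 j) //= eqxx.
  rewrite -addSn; apply: leq_add; first by case: ifP => _; lia.
  by apply: leq_sum => i ij; rewrite (negbTE ij); case: ifP => _; lia.
have -> : G * s ^- #|op| * L%:R ^+ excess op c * (B * L%:R) =
  (B * G * s ^- #|op|) * L%:R ^+ (excess op c).+1 by rewrite exprS; ring.
apply: ler_wpM2l; last by apply: ler_weXn2l => //; rewrite ler1n.
by rewrite !mulr_ge0 // invr_ge0 exprn_ge0 // ltW.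
Qed.

Lemma state_bound_ge0 (tree : {set E}) (m : E -> nat) c : 0 <= state_bound tree m c.
Proof.
by rewrite !mulr_ge0 ?state_weight_ge0 ?exprn_ge0 // invr_ge0 exprn_ge0 // ltW.
Qed.

Lemma walk_sum_state_le a t (vis : {set I}) (tree : {set E}) (m : E -> nat) c :
  good_state vis tree m -> c \in vis -> (#|vis| + t <= L)%N ->
  `|walk_sum a t m c| <= state_bound tree m c * growth ^+ t.
Proof.
elim: t vis tree m c => [|t IH] vis tree m c g cv hL.
  rewrite expr0 mulr1 /= normrM; have L0 : (0 < L)%N.
    by have: (0 < #|vis|)%N by [apply/card_gt0P; exists c]; lia.
  apply: le_trans (_ : `|\prod_e mom e (m e)| <= _).
    by rewrite ler_piMl // normr_nat lern1; case: eqP.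
  (* An edge still open at the end contributes a first moment, which is 0. Otherwise every tree edge
     has multiplicity at least 2 and the variance bound applies. *)
  case: (set_0Vmem (open_edges tree m)) => [o0|[e eo]]; last first.
    rewrite (bigD1 e) //=; move: eo; rewrite inE => /andP[_ /eqP ->].
    by rewrite mom1 mul0r normr0 state_bound_ge0.
  rewrite /state_bound o0 cards0 expr0 invr1 mulr1.
  apply: le_trans (_ : state_weight tree m <= _); last first.
    by rewrite ler_peMr ?state_weight_ge0 // exprn_ege1 // ler1n.
  rewrite normr_prod; apply: ler_prod => e _; rewrite normr_ge0 /=.
  case: ifP => et; last exact: mom_le.
  apply: mom_ge2_le; have := (proj2 g) e et.
  have /setP/(_ e) := o0; rewrite !inE et /=.
  by case: (m e) => [|[]].
have vL : (#|vis| <= L)%N by lia.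
have L0 : (0 < L)%N by lia.
set sb := state_bound tree m c; set op := open_edges tree m.
have sb0 : 0 <= sb by apply: state_bound_ge0.
have gr0 := growth_ge0.
(* Each target is charged for discovery, closing and revisit at once; summed over [j] the three
   charges are at most [s], [s] and B L^2, which is [growth]. *)
apply: le_trans (_ : \sum_j (sb * growth ^+ t) *
   ((if edge c j is Some e then v e else 0) / s +
    (joined_by op c j)%:R * (s / (open_deg op c)%:R) +
    (j \in vis)%:R * (B * L%:R)) <= _); last first.
  rewrite -mulr_sumr exprSr mulrA; apply: ler_wpM2l.
    by rewrite mulr_ge0 // exprn_ge0.
  rewrite !big_split /= -!mulr_suml /growth.
  have h1 : (\sum_j (if edge c j is Some e then v e else 0)) / s <= s.
    by rewrite ler_pdivrMr // -expr2 row_var_le.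
  have h2 : (\sum_j (joined_by op c j)%:R) * (s / (open_deg op c)%:R) <= s.
    have -> : \sum_j (joined_by op c j)%:R = (open_deg op c)%:R :> R.
      by rewrite -natr_sum -big_mkcond /= sum1_card /open_deg cardsE.
    case: (posnP (open_deg op c)) => [->|d0]; first by rewrite mul0r ltW.
    by rewrite mulrC divfK // pnatr_eq0 -lt0n.
  have h3 : (\sum_j (j \in vis)%:R) * (B * L%:R) <= B * L%:R ^+ 2.
    rewrite -natr_sum -big_mkcond /= sum1_card expr2 mulrC -mulrA.
    by rewrite ler_wpM2l // ler_wpM2l // ler_nat.
  by rewrite [2 * s]mulr_natl mulr2n !lerD.
apply: le_trans (ler_norm_sum _ _ _) _; apply: ler_sum => j _.
have hterm (vis' : {set I}) tree' e x : j \in vis' -> good_state vis' tree' (incr_at e m) ->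
    (#|vis'| + t <= L)%N -> state_bound tree' (incr_at e m) j <= sb * x ->
    `|walk_sum a t (incr_at e m) j| <= sb * growth ^+ t * x.
  move=> jv' g' hL' hx; apply: le_trans (IH vis' tree' _ _ g' jv' hL') _.
  by rewrite [leRHS]mulrAC; apply: ler_wpM2r => //; rewrite exprn_ge0.
have e1 : 0 <= s / (open_deg op c)%:R by rewrite divr_ge0 // ltW.
have e2 : 0 <= B * L%:R by rewrite mulr_ge0.
case cj: (edge c j) => [e|]; last first.
  rewrite normr0 /joined_by cj; apply: mulr_ge0.
    by rewrite mulr_ge0 // exprn_ge0.
  by rewrite !(mul0r, add0r) mulr_ge0.
rewrite /joined_by cj.
have e3 : 0 <= v e / s by rewrite divr_ge0 // ltW.
have wl x y : x <= y -> sb * growth ^+ t * x <= sb * growth ^+ t * y.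
  by move=> xy; apply: ler_wpM2l => //; rewrite mulr_ge0 // exprn_ge0.
case: (boolP (j \in vis)) => jv.
  case: (boolP (e \in op)) => eo.
    have [_ g' hb] := close_edge_bound vL g cv cj eo.
    apply: le_trans (hterm vis tree e _ jv g' _ hb) _; first by apply: leq_trans hL;
      rewrite leq_add2l.
    by apply: wl; rewrite !mul1r addrAC lerDr addr_ge0.
  have [g' hb] := revisit_bound L0 g cv jv cj eo.
  apply: le_trans (hterm vis tree e _ jv g' _ hb) _; first by apply: leq_trans hL;
    rewrite leq_add2l.
  by apply: wl; rewrite mul0r addr0 mul1r lerDr.
have [g' hb] := new_vertex_bound L0 g cv jv cj.
apply: le_trans (hterm (j |: vis) (e |: tree) e _ _ g' _ hb) _.
- by rewrite setU11.
- by rewrite cardsU1 jv add1n addSnnS.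
apply: wl; rewrite mul0r addr0 lerDl.
by case: (e \in op); rewrite ?mul0r ?mul1r.
Qed.

End WalkSum.

(** A walk of [t] steps sees at most t + 1 vertices, so [L] is taken to be [t.+1]; the potential of
    the initial state is 1. *)
Lemma closed_walk_sum_le (R : realFieldType) (I E : finType)
    (edge : I -> I -> option E) (mom : E -> nat -> R) (v : E -> R) (B s : R)
    (a : I) (t : nat) :
  (forall i j, edge i j = edge j i) ->
  (forall i j k l e, edge i j = Some e -> edge k l = Some e ->
    (i = k /\ j = l) \/ (i = l /\ j = k)) ->
  (forall e, 0 <= v e) -> 0 <= B -> 0 < s ->
  (forall e, mom e 1 = 0) ->
  (forall e k, `|mom e k| <= B ^+ k) ->
  (forall e k, (2 <= k)%N -> `|mom e k| <= v e * B ^+ (k - 2)) ->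
  (forall c, \sum_j (if edge c j is Some e then v e else 0) <= s ^+ 2) ->
  `|walk_sum edge mom a t (fun=> 0%N) a| <= (2 * s + B * t.+1%:R ^+ 2) ^+ t.
Proof.
move=> es ei v0 B0 s0 m1 mB m2 rv.
have g : good_state edge [set a] set0 (fun=> 0%N) by split=> // e; rewrite inE.
have := walk_sum_state_le es ei v0 B0 s0 m1 mB m2 rv (L := t.+1) a (t := t) g (set11 a).
rewrite cards1 add1n => /(_ (leqnn _)) /le_trans; apply.
rewrite ler_piMl ?exprn_ge0 ?addr_ge0 ?mulr_ge0 ?exprn_ge0 // ?(ltW s0) //.
rewrite /state_bound /state_weight.
have -> : open_edges set0 (fun=> 0%N) = set0 :> {set E} by apply/setP => e; rewrite !inE.
rewrite big1 => [|e _]; last by rewrite inE expr0.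
have -> : excess edge set0 a = 0%N.
  rewrite /excess big1 // => i _; rewrite (_ : open_deg _ _ _ = 0%N) //.
  apply/eqP; rewrite cards_eq0; apply/eqP/setP => j; rewrite !inE /joined_by.
  by case: (edge i j) => // e; rewrite inE.
by rewrite cards0 !expr0 invr1 !mulr1.
Qed.

(** * Frobenius norms, operator norms and traces *)

Section SquaredNorm.
Variable R : realFieldType.

Definition sqnorm m n (A : 'M[R]_(m, n)) : R := \sum_i \sum_j A i j ^+ 2.

Lemma sqnorm_ge0 m n (A : 'M[R]_(m, n)) : 0 <= sqnorm A.
Proof. by rewrite !sumr_ge0 // => i _; rewrite sumr_ge0 // => j _; rewrite sqr_ge0. Qed.

Lemma sqnorm_trmx m n (A : 'M[R]_(m, n)) : sqnorm A^T = sqnorm A.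
Proof.
rewrite /sqnorm exchange_big; apply: eq_bigr => i _.
by apply: eq_bigr => j _; rewrite mxE.
Qed.

Lemma sqnorm_tr m n (A : 'M[R]_(m, n)) : sqnorm A = \tr (A *m A^T).
Proof.
apply: eq_bigr => i _; rewrite !mxE; apply: eq_bigr => j _.
by rewrite mxE expr2.
Qed.

Lemma sqnorm_rows m n (A : 'M[R]_(m, n)) : sqnorm A = \sum_i sqnorm (row i A).
Proof.
apply: eq_bigr => i _; rewrite /sqnorm big_ord1.
by apply: eq_bigr => j _; rewrite mxE.
Qed.

Lemma sqnormZ m n c (A : 'M[R]_(m, n)) : sqnorm (c *: A) = c ^+ 2 * sqnorm A.
Proof.
rewrite /sqnorm mulr_sumr; apply: eq_bigr => i _; rewrite mulr_sumr.
by apply: eq_bigr => j _; rewrite mxE exprMn.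
Qed.

Lemma sqnormN m n (A : 'M[R]_(m, n)) : sqnorm (- A) = sqnorm A.
Proof. by rewrite -scaleN1r sqnormZ sqrrN expr1n mul1r. Qed.

(** The free weight [k] keeps the factor on the noise close to 1 at the price of a large factor on
    the other term; the gap between threshold and noise is only of order [eta], so a factor 2 on the
    noise would be too much. *)
Lemma sqnormD_le m n (k : R) (A B : 'M[R]_(m, n)) : 0 < k ->
  sqnorm (A + B) <= (1 + k) * sqnorm A + (1 + k^-1) * sqnorm B.
Proof.
move=> k0; rewrite /sqnorm !mulr_sumr -big_split /=; apply: ler_sum => i _.
rewrite !mulr_sumr -big_split /=; apply: ler_sum => j _; rewrite mxE.
set a := A i j; set b := B i j; rewrite -subr_ge0.
have -> : (1 + k) * a ^+ 2 + (1 + k^-1) * b ^+ 2 - (a + b) ^+ 2 =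
  k^-1 * (k * a - b) ^+ 2 by field; rewrite gt_eqF.
by rewrite mulr_ge0 ?sqr_ge0 // invr_ge0 ltW.
Qed.

Lemma sum_mul_sqr_le (I : finType) (f g : I -> R) :
  (\sum_i f i * g i) ^+ 2 <= (\sum_i f i ^+ 2) * (\sum_i g i ^+ 2).
Proof.
set a := \sum_i f i ^+ 2; set b := \sum_i g i ^+ 2; set c := \sum_i f i * g i.
have b0 : 0 <= b by apply: sumr_ge0 => i _; rewrite sqr_ge0.
have [b_eq0|b_neq0] := eqVneq b 0.
  rewrite b_eq0 mulr0 /c big1 ?expr0n // => i _.
  have /eqP := b_eq0; rewrite psumr_eq0 => [/allP/(_ i)|j _]; last exact: sqr_ge0.
  by rewrite mem_index_enum sqrf_eq0 => /(_ isT) /= /eqP ->; rewrite mulr0.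
have bp : 0 < b by rewrite lt_neqAle eq_sym b_neq0.
have : 0 <= \sum_i (b * f i - c * g i) ^+ 2 by apply: sumr_ge0 => i _; rewrite sqr_ge0.
have -> : \sum_i (b * f i - c * g i) ^+ 2 = b * (b * a - c ^+ 2).
  transitivity (\sum_i (b ^+ 2 * f i ^+ 2 + (- (2 * b * c)) * (f i * g i) + c ^+ 2 * g i ^+ 2)).
    by apply: eq_bigr => i _; ring.
  by rewrite !big_split /= -!mulr_sumr -/a -/b -/c; ring.
by rewrite pmulr_rge0 // subr_ge0 [b * a]mulrC.
Qed.

Lemma sqnorm_mul_le m n q (A : 'M[R]_(m, n)) (B : 'M[R]_(n, q)) :
  sqnorm (A *m B) <= sqnorm A * sqnorm B.
Proof.
rewrite {2}/sqnorm mulr_suml; apply: ler_sum => i _.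
rewrite -[sqnorm B]sqnorm_trmx /sqnorm mulr_sumr; apply: ler_sum => j _.
rewrite mxE; apply: le_trans (sum_mul_sqr_le _ _) _; apply: ler_wpM2l.
  by apply: sumr_ge0 => l _; rewrite sqr_ge0.
by apply: ler_sum => l _; rewrite mxE.
Qed.

Lemma tr_mul_sqr_le m n (A B : 'M[R]_(m, n)) :
  (\tr (A *m B^T)) ^+ 2 <= sqnorm A * sqnorm B.
Proof.
rewrite /sqnorm !pair_big /=.
apply: le_trans (sum_mul_sqr_le (fun p => A p.1 p.2) (fun p => B p.1 p.2)).
rewrite -(pair_big xpredT xpredT (fun i j => A i j * B i j)) /=.
rewrite le_eqVlt; apply/orP; left; apply/eqP; congr (_ ^+ 2).
by apply: eq_bigr => i _; rewrite mxE; apply: eq_bigr => j _; rewrite mxE.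
Qed.

(** The ratios of consecutive terms do not decrease, so (a_1 / a_0)^(k+1) is at most their
    telescoping product a_(k+1) / a_0. The form without division also covers sequences with
    zeros. *)
Lemma log_convex_expr_le (a : nat -> R) (k : nat) : (forall j, 0 <= a j) ->
  (forall j, a j.+1 ^+ 2 <= a j * a j.+2) -> a 1%N ^+ k.+1 <= a k.+1 * a 0%N ^+ k.
Proof.
move=> a0 lc; have [a1|a1] := eqVneq (a 1%N) 0.
  by rewrite a1 expr0n /= mulr_ge0 // exprn_ge0.
have ap j : 0 < a j.+1.
  elim: j => [|j IH]; first by rewrite lt_neqAle eq_sym a1 a0.
  rewrite lt_neqAle a0 andbT; move: (lc j); apply: contraTneq => <-.
  by rewrite mulr0 -ltNge exprn_gt0.
have h j : a 1%N * a j <= a 0%N * a j.+1.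
  elim: j => [|j IH]; first by rewrite mulrC.
  rewrite -(ler_pM2r (ap j)) -mulrA -expr2.
  apply: le_trans (_ : a 1%N * (a j * a j.+2) <= _).
    by rewrite ler_wpM2l.
  by rewrite mulrA [leRHS]mulrAC ler_wpM2r.
elim: k => [|k IH]; first by rewrite expr0 expr1 mulr1.
rewrite exprS; apply: le_trans (_ : a 1%N * (a k.+1 * a 0%N ^+ k) <= _).
  by rewrite ler_wpM2l.
rewrite mulrA exprS [leRHS]mulrA [a k.+2 * _]mulrC.
by rewrite ler_wpM2r // exprn_ge0.
Qed.

(** The bound is on the square of the operator norm, so that no square roots are needed over a
    [realFieldType]. *)
Definition opnorm2_le m n (t : R) (A : 'M[R]_(m, n)) : Prop :=
  forall v : 'cV[R]_n, sqnorm (A *m v) <= t * sqnorm v.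

(* The squared norms of the iterates H^j v form a log-convex sequence, so the
   first one is controlled by any later one, hence by a high moment. *)
Lemma opnorm2_le_trace_power n (H : 'M[R]_n) (k : nat) (t : R) :
  H^T = H -> 0 <= t -> \tr (H ^+ (k.+1).*2) <= t ^+ k.+1 -> opnorm2_le t H.
Proof.
move=> Hs t0 htr v.
have HS j : H ^+ j.+1 = H *m H ^+ j by exact: exprS.
have HSr j : H ^+ j.+1 = H ^+ j *m H by exact: exprSr.
have Hp j : (H ^+ j)^T = H ^+ j.
  elim: j => [|j IH]; first by rewrite !expr0 trmx1.
  by rewrite HS trmx_mul IH Hs -HSr.
have := @log_convex_expr_le (fun j => sqnorm (H ^+ j *m v)) k (fun j => sqnorm_ge0 _).
rewrite expr0 expr1 mul1mx => lc.
have {}lc : sqnorm (H *m v) ^+ k.+1 <= sqnorm (H ^+ k.+1 *m v) * sqnorm v ^+ k.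
  (* By symmetry of [H], the squared norm of H^(j+1) v is the inner product of H^j v and H^(j+2) v;
     Cauchy-Schwarz then gives log-convexity. *)
  apply: lc => j; rewrite [in leLHS]sqnorm_tr.
  have -> : \tr (H ^+ j.+1 *m v *m (H ^+ j.+1 *m v)^T) =
     \tr ((H ^+ j *m v) *m (H ^+ j.+2 *m v)^T).
    rewrite !HS -!mulmxA; set w := H ^+ j *m v.
    by rewrite !trmx_mul !Hs -!mulmxA mxtrace_mulC -!mulmxA.
  exact: tr_mul_sqr_le.
have [v0|vp] := eqVneq (sqnorm v) 0.
  by apply: le_trans (sqnorm_mul_le _ _) _; rewrite v0 !mulr0.
have tv0 : 0 <= t * sqnorm v by rewrite mulr_ge0 // sqnorm_ge0.
rewrite -(ler_pXn2r (ltn0Sn k)) ?nnegrE ?sqnorm_ge0 //.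
apply: le_trans lc _; rewrite exprMn [sqnorm v ^+ k.+1]exprS mulrA.
apply: ler_wpM2r; first by rewrite exprn_ge0 // sqnorm_ge0.
apply: le_trans (sqnorm_mul_le _ _) _; apply: ler_wpM2r; first exact: sqnorm_ge0.
by apply: le_trans htr; rewrite sqnorm_tr Hp -[_ *m _]/(_ * _) -exprD addnn.
Qed.

Lemma sqnorm_mull_le m n q t (A : 'M[R]_(m, n)) (B : 'M[R]_(n, q)) :
  opnorm2_le t A -> sqnorm (A *m B) <= t * sqnorm B.
Proof.
move=> hA; rewrite -sqnorm_trmx -[sqnorm B]sqnorm_trmx sqnorm_rows.
rewrite [sqnorm B^T]sqnorm_rows mulr_sumr; apply: ler_sum => i _.
rewrite trmx_mul row_mul -sqnorm_trmx trmx_mul trmxK.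
by rewrite -[X in _ <= _ * X]sqnorm_trmx; apply: hA.
Qed.

(** With w = A^T v, the squared norm of w is the inner product of v and A w; Cauchy-Schwarz bounds
    its square by t |v|^2 |w|^2, and |w|^2 cancels. *)
Lemma opnorm2_le_trmx m n t (A : 'M[R]_(m, n)) : 0 <= t ->
  opnorm2_le t A -> opnorm2_le t A^T.
Proof.
move=> t0 hA v; set w := A^T *m v.
have [->|w0] := eqVneq (sqnorm w) 0; first by rewrite mulr_ge0 // sqnorm_ge0.
have wp : 0 < sqnorm w by rewrite lt_neqAle eq_sym w0 sqnorm_ge0.
rewrite -(ler_pM2r wp) -expr2.
have wE : sqnorm w = \tr (v *m (A *m w)^T).
  by rewrite sqnorm_tr [(A *m w)^T]trmx_mul mulmxA [RHS]mxtrace_mulC mulmxA.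
rewrite {1}wE; apply: le_trans (tr_mul_sqr_le _ _) _.
rewrite [leRHS]mulrAC mulrC; apply: ler_wpM2r; first exact: sqnorm_ge0.
exact: hA.
Qed.

Lemma sqnorm_mulr_le m n q t (A : 'M[R]_(m, n)) (B : 'M[R]_(q, m)) : 0 <= t ->
  opnorm2_le t A -> sqnorm (B *m A) <= t * sqnorm B.
Proof.
move=> t0 hA; rewrite -sqnorm_trmx -[sqnorm B]sqnorm_trmx trmx_mul.
exact/sqnorm_mull_le/opnorm2_le_trmx.
Qed.

(** The self-adjoint dilation sends (0, v) to (A v, 0). *)
Lemma opnorm2_le_block m n t (A : 'M[R]_(m, n)) :
  opnorm2_le t (block_mx 0 A A^T 0) -> opnorm2_le t A.
Proof.
move=> h v; have := h (col_mx 0 v).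
rewrite mul_block_col !mul0mx !mulmx0 add0r addr0.
by rewrite -[sqnorm (col_mx 0 v)]sqnorm_trmx -[sqnorm (col_mx _ 0)]sqnorm_trmx
 !tr_col_mx trmx0 !sqnorm_tr !tr_row_mx !mul_row_col !trmx0 !mulmx0 add0r addr0
 -!sqnorm_tr !sqnorm_trmx.
Qed.

End SquaredNorm.

(** * Singular value thresholding *)

Section Threshold.
Variables (R : realFieldType) (n : nat).
Implicit Types (A B Q U V : 'M[R]_n).

Lemma sqnorm_orthogonal m U (X : 'M[R]_(n, m)) : U *m U^T = 1%:M ->
  sqnorm (U *m X) = sqnorm X.
Proof.
move=> /mulmx1C UU; rewrite -sqnorm_trmx sqnorm_tr trmxK trmx_mul mulmxA.
by rewrite -[X^T *m _ *m U]mulmxA UU mulmx1 -{2}[X]trmxK -sqnorm_tr sqnorm_trmx.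
Qed.

Lemma sqnorm_projection m Q (Y : 'M[R]_(m, n)) : Q^T = Q -> Q *m Q = Q ->
  sqnorm Y = sqnorm (Y *m Q) + sqnorm (Y *m (1%:M - Q)).
Proof.
move=> Qs QQ; have Q's : (1%:M - Q)^T = 1%:M - Q by rewrite linearB /= trmx1 Qs.
rewrite !sqnorm_tr -mxtraceD !trmx_mul Q's Qs !mulmxA.
rewrite -[Y *m Q *m Q]mulmxA QQ -[Y *m (_ - _) *m (_ - _)]mulmxA.
rewrite mulmxBr mulmx1 mulmxBl mul1mx QQ subrr subr0 -mulmxDl -mulmxDr.
by rewrite addrC subrK mulmx1.
Qed.

Variables (U V B Q : 'M[R]_n) (s : 'I_n -> R) (S : pred 'I_n).
Variables (t2 d2 r k : R).
(** The rows of [U] and [V] are the singular vectors of [A], the observed matrix; [B] is the signal,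
    [D] the noise and [E] the part of the signal that the projection [Q] misses. The squared norm of
    a projection is its trace, so [Qr] is a bound on the rank. *)
Let A := U^T *m (\matrix_(i, j) (s i * V i j)).
Let D := A - B.
Let E := B *m (1%:M - Q).
Hypotheses (UU : U *m U^T = 1%:M) (VV : V *m V^T = 1%:M).
Hypotheses (Qs : Q^T = Q) (QQ : Q *m Q = Q) (Qr : sqnorm Q <= r).
Hypotheses (t2_ge0 : 0 <= t2) (d2_ge0 : 0 <= d2) (k_gt0 : 0 < k).
Hypothesis D_le : opnorm2_le d2 D.
Hypotheses (S_ge : forall i, S i -> t2 <= s i ^+ 2).
Hypotheses (NS_le : forall i, ~~ S i -> s i ^+ 2 <= t2).

Let rowUT m (X : 'M[R]_(n, m)) i : row i U *m (U^T *m X) = row i X.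
Proof. by rewrite -row_mul mulmxA UU mul1mx. Qed.

Let rowUA i : row i U *m A = s i *: row i V.
Proof.
rewrite /A rowUT; apply/matrixP => a b; rewrite !mxE.
by [].
Qed.

Let sqnorm_row_orth (W : 'M[R]_n) i : W *m W^T = 1%:M -> sqnorm (row i W) = 1.
Proof.
move=> WW; rewrite sqnorm_tr tr_row -row_mul; move: WW => /(congr1 (fun M : 'M[R]_n => M i i)).
rewrite !mxE eqxx mulr1n => <-; rewrite /mxtrace big_ord1 !mxE.
by apply: eq_bigr => j _; rewrite !mxE.
Qed.

Let rowUD_le i : sqnorm (row i U *m D) <= d2.
Proof.
by apply: le_trans (sqnorm_mulr_le _ d2_ge0 D_le) _; rewrite sqnorm_row_orth ?mulr1.
Qed.

Let sum_rows_orth m (W : 'M[R]_n) (X : 'M[R]_(n, m)) : W *m W^T = 1%:M ->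
  \sum_i sqnorm (row i W *m X) = sqnorm X.
Proof.
move=> WW; rewrite -(sqnorm_orthogonal X WW) sqnorm_rows.
by apply: eq_bigr => i _; rewrite row_mul.
Qed.

Let sum_sub_le (P : pred 'I_n) (f : 'I_n -> R) : (forall i, 0 <= f i) ->
  \sum_(i | P i) f i <= \sum_i f i.
Proof. by move=> f0; rewrite [leRHS](bigID P) /= lerDl sumr_ge0. Qed.

(* Outside the range of Q a left singular row u_i satisfies
   s_i v_i (1 - Q) = u_i D (1 - Q) + u_i E, and the rows v_i Q have total
   squared norm at most r. *)
Lemma card_threshold_le :
  #|S|%:R * (t2 - (1 + k) * d2) <= r * t2 + (1 + k^-1) * sqnorm E.
Proof.
have h i : S i -> t2 - (1 + k) * d2 <=
    t2 * sqnorm (row i V *m Q) + (1 + k^-1) * sqnorm (row i U *m E).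
  move=> Si; have hV := sqnorm_projection (row i V) Qs QQ.
  rewrite sqnorm_row_orth // in hV.
  have hs : s i ^+ 2 * sqnorm (row i V *m (1%:M - Q)) <=
      (1 + k) * d2 + (1 + k^-1) * sqnorm (row i U *m E).
    rewrite -sqnormZ scalemxAl -rowUA.
    have -> : row i U *m A *m (1%:M - Q) = row i U *m D *m (1%:M - Q) + row i U *m E.
      by rewrite /E mulmxA -mulmxDl -mulmxDr /D subrK.
    apply: le_trans (sqnormD_le _ _ k_gt0) _; rewrite lerD2r.
    apply: ler_wpM2l; first by rewrite addr_ge0 // ltW.
    apply: le_trans (rowUD_le i).
    by rewrite [leRHS](sqnorm_projection _ Qs QQ) lerDr sqnorm_ge0.
  have hm : t2 * sqnorm (row i V *m (1%:M - Q)) <= s i ^+ 2 * sqnorm (row i V *m (1%:M - Q)).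
    by apply: ler_wpM2r; rewrite ?sqnorm_ge0 ?S_ge.
  have e1 : t2 * 1 = t2 * sqnorm (row i V *m Q) + t2 * sqnorm (row i V *m (1%:M - Q)).
    by rewrite {1}hV mulrDr.
  have := le_trans hm hs; lra.
rewrite -sum1_card natr_sum mulr_suml.
apply: le_trans (_ : \sum_(i in S) (t2 * sqnorm (row i V *m Q) +
  (1 + k^-1) * sqnorm (row i U *m E)) <= _).
  by apply: ler_sum => i Si; rewrite mul1r h.
rewrite big_split /= -!mulr_sumr; apply: lerD.
  rewrite mulrC; apply: ler_wpM2r => //; apply: le_trans Qr.
  by rewrite -(sum_rows_orth Q VV) sum_sub_le // => i; rewrite sqnorm_ge0.
apply: ler_wpM2l; first by rewrite addr_ge0 // invr_ge0 ltW.
by rewrite -(sum_rows_orth E UU) sum_sub_le // => i; rewrite sqnorm_ge0.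
Qed.

(** The error is split along the rows u_i of [U]. On a kept row it is u_i D, of squared norm at most
    [d2]. On a discarded row it is -u_i B, whose part outside [Q] is u_i E and whose part inside is
    s_i v_i Q - u_i D Q; there s_i^2 is at most [t2], and both v_i Q and D Q are controlled by the
    rank of [Q]. *)
Lemma sqnorm_threshold_le :
  sqnorm (U^T *m (\matrix_(i, j) (if S i then s i * V i j else 0)) - B) <=
  #|S|%:R * d2 + 2 * (t2 + d2) * r + sqnorm E.
Proof.
rewrite -(sum_rows_orth _ UU) (bigID S) /= -addrA; apply: lerD.
  rewrite -sum1_card natr_sum mulr_suml; apply: ler_sum => i Si; rewrite mul1r.
  rewrite mulmxBr rowUT.
  have -> : row i (\matrix_(i, j) (if S i then s i * V i j else 0)) = row i U *m A.
    rewrite rowUA; apply/matrixP => a b; rewrite !mxE.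
    by rewrite Si.
  by rewrite -mulmxBr rowUD_le.
have h i : ~~ S i ->
    sqnorm (row i U *m (U^T *m (\matrix_(i, j) (if S i then s i * V i j else 0)) - B)) <=
    2 * t2 * sqnorm (row i V *m Q) + 2 * sqnorm (row i U *m (D *m Q)) + sqnorm (row i U *m E).
  move=> NSi; rewrite mulmxBr rowUT.
  have -> : row i (\matrix_(i, j) (if S i then s i * V i j else 0)) = 0 :> 'M[R]_(1, n).
    by apply/matrixP => a b; rewrite !mxE (negbTE NSi).
  rewrite sub0r sqnormN (sqnorm_projection _ Qs QQ) -[_ *m B *m (_ - _)]mulmxA lerD2r.
  have -> : row i U *m B *m Q = s i *: (row i V *m Q) + - (row i U *m (D *m Q)).
    by rewrite scalemxAl -rowUA [row i U *m (D *m Q)]mulmxA -mulmxBl -mulmxBr /D opprB addrC subrK.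
  apply: le_trans (sqnormD_le _ _ ltr01) _; rewrite invr1 sqnormN sqnormZ lerD2r -mulrA.
  rewrite ler_wpM2l // ?addr_ge0 //; apply: ler_wpM2r; first exact: sqnorm_ge0.
  exact: NS_le.
apply: le_trans (_ : \sum_(i | ~~ S i) (2 * t2 * sqnorm (row i V *m Q) +
  2 * sqnorm (row i U *m (D *m Q)) + sqnorm (row i U *m E)) <= _).
  by apply: ler_sum => i; apply: h.
apply: le_trans (sum_sub_le _ _) _ => [i|].
  by rewrite !addr_ge0 ?mulr_ge0 ?sqnorm_ge0.
rewrite !big_split /= -!mulr_sumr !sum_rows_orth // lerD2r.
have h1 : 2 * t2 * sqnorm Q <= 2 * t2 * r by rewrite ler_wpM2l // mulr_ge0.
have h2 : 2 * sqnorm (D *m Q) <= 2 * (d2 * r).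
  rewrite ler_wpM2l //; apply: le_trans (sqnorm_mull_le _ D_le) _.
  by rewrite ler_wpM2l.
lra.
Qed.

End Threshold.

(** * Averaging the columns over classes of indices *)

Section ClassAverage.
Variables (R : realFieldType) (n r : nat) (c : 'I_n -> 'I_r).

Let class_card (a : 'I_r) : R := #|[set l | c l == a]|%:R.

Definition class_average : 'M[R]_n :=
  \matrix_(i, j) ((c i == c j)%:R / class_card (c i)).

Let class_card_neq0 i : class_card (c i) != 0.
Proof.
by rewrite pnatr_eq0 -lt0n; apply/card_gt0P; exists i; rewrite inE.
Qed.

Lemma class_average_sym : class_average^T = class_average.
Proof.
apply/matrixP => i j; rewrite !mxE eq_sym.
by case: eqP => [->|]; rewrite ?mul0r.
Qed.

Let sum_class (a : 'I_r) : \sum_l (c l == a)%:R = class_card a.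
Proof. by rewrite -natr_sum -big_mkcond sum1_card /class_card cardsE. Qed.

Lemma class_average_idem : class_average *m class_average = class_average.
Proof.
apply/matrixP => i j; rewrite !mxE.
transitivity (\sum_l (c l == c i)%:R * ((c i == c j)%:R / class_card (c i) ^+ 2)).
  apply: eq_bigr => l _; rewrite !mxE eq_sym; case: eqP => [->|_]; rewrite ?mul0r //.
  by rewrite !mul1r expr2 invfM; ring.
rewrite -mulr_suml sum_class; field; exact: class_card_neq0.
Qed.

(** The squared norm of a symmetric idempotent is its trace, to which each nonempty class
    contributes 1. A class may be empty, hence only an inequality. *)
Lemma sqnorm_class_average_le : sqnorm class_average <= r%:R.
Proof.
rewrite sqnorm_tr class_average_sym class_average_idem /mxtrace.
rewrite (partition_big c xpredT) //=.
apply: le_trans (_ : \sum_(a < r) 1 <= _); last by rewrite sumr_const card_ord.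
apply: ler_sum => a _.
rewrite (eq_bigr (fun=> (class_card a)^-1)) => [|i /eqP <-]; last first.
  by rewrite mxE eqxx mul1r.
rewrite sumr_const -[X in X <= _]mulr_natr -cardsE mulrC.
by have [->|h] := eqVneq (class_card a) 0; rewrite ?invr0 ?mulr0 // divff.
Qed.

(** The columns of [class_average] sum to 1, so entry (i, j) of the residue is the mean of
    [M i j - M i l] over the [l] in the class of [j]. *)
Lemma sqnorm_class_average_residue_le m (M : 'M[R]_(m, n)) (h : R) : 0 <= h ->
  (forall i j l, c j = c l -> `|M i j - M i l| <= h) ->
  sqnorm (M *m (1%:M - class_average)) <= (m * n)%:R * h ^+ 2.
Proof.
move=> h0 hM; apply: le_trans (_ : \sum_(i < m) \sum_(j < n) h ^+ 2 <= _); last first.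
  by rewrite !sumr_const !card_ord -mulrnA mulr_natl mulnC.
apply: ler_sum => i _; apply: ler_sum => j _.
rewrite -real_normK ?num_real // lerXn2r ?nnegrE //.
have q1 : \sum_l class_average l j = 1.
  rewrite (eq_bigr (fun l => (c l == c j)%:R / class_card (c j))) => [|l _].
    by rewrite -mulr_suml sum_class divff.
  by rewrite mxE; case: eqP => [->|]; rewrite ?mul0r.
have -> : (M *m (1%:M - class_average)) i j = \sum_l (M i j - M i l) * class_average l j.
  rewrite mulmxBr mulmx1 !mxE -[M i j in LHS]mulr1 -q1 mulr_sumr -sumrB.
  by apply: eq_bigr => l _; rewrite mulrBl.
apply: le_trans (ler_norm_sum _ _ _) _; rewrite -[leRHS]mulr1 -[X in _ <= _ * X]q1 mulr_sumr.
apply: ler_sum => l _; rewrite normrM !mxE; case: eqP => [e|_]; last first.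
  by rewrite mul0r normr0 !mulr0.
rewrite mul1r [X in _ * X <= _]ger0_norm ?invr_ge0 ?ler0n //.
by apply: ler_wpM2r; rewrite ?invr_ge0 ?ler0n // hM.
Qed.

End ClassAverage.

From mathcomp Require Import all_classical all_reals all_analysis.
From mathcomp Require Import measurable_realfun.

Import numFieldNormedType.Exports.

Local Open Scope classical_set_scope.

(** * Bounded random variables and independence *)

Section BoundedExpectation.
Context d (T : measurableType d) (R : realType) (P : probability T R).
Implicit Types f g : T -> R.

(** The bound holds everywhere, so sums, products and powers stay integrable without side
    conditions. *)
Definition bounded_rv f : Prop :=
  measurable_fun [set: T] f /\ exists C : R, forall w, `|f w| <= C.

Definition Rexp f : R := \int[P]_w f w.

Lemma bounded_rv_integrable f : bounded_rv f -> P.-integrable [set: T] (EFin \o f).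
Proof.
case=> mf [C fC]; apply: measurable_bounded_integrable => //.
  exact: le_lt_trans (probability_le1 P measurableT) (ltry _).
exists C; split; first exact: num_real.
by move=> M CM w _; apply: le_trans (fC w) (ltW CM).
Qed.

Lemma bounded_rv_cst (c : R) : bounded_rv (cst c).
Proof. by split; [exact: measurable_cst|exists `|c|]. Qed.

Lemma bounded_rvD f g : bounded_rv f -> bounded_rv g -> bounded_rv (fun w => f w + g w).
Proof.
move=> [mf [C fC]] [mg [D gD]]; split; first exact: measurable_funD.
by exists (C + D) => w; apply: le_trans (ler_normD _ _) _; rewrite lerD.
Qed.

Lemma bounded_rvM f g : bounded_rv f -> bounded_rv g -> bounded_rv (fun w => f w * g w).
Proof.
move=> [mf [C fC]] [mg [D gD]]; split; first exact: measurable_funM.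
by exists (C * D) => w; rewrite normrM ler_pM.
Qed.

Lemma bounded_rvZ (c : R) f : bounded_rv f -> bounded_rv (fun w => c * f w).
Proof. by move=> bf; apply: bounded_rvM => //; apply: bounded_rv_cst. Qed.

Lemma bounded_rvX f k : bounded_rv f -> bounded_rv (fun w => f w ^+ k).
Proof.
move=> bf; elim: k => [|k IH].
  by rewrite (_ : (fun w => _) = cst 1); [exact: bounded_rv_cst|apply/funext].
rewrite (_ : (fun w => _) = (fun w => f w * f w ^+ k)); first exact: bounded_rvM.
by apply/funext => w; rewrite exprS.
Qed.

Lemma bounded_rv_sum (I : Type) (r : seq I) (Q : pred I) (f : I -> T -> R) :
  (forall i, Q i -> bounded_rv (f i)) -> bounded_rv (fun w => \sum_(i <- r | Q i) f i w).
Proof.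
move=> bf; elim: r => [|i r IH].
  by rewrite (_ : (fun w => _) = cst 0); [exact: bounded_rv_cst|apply/funext => w; rewrite big_nil].
case: (boolP (Q i)) => Qi; last first.
  by rewrite (_ : (fun w => _) = (fun w => \sum_(i <- r | Q i) f i w)) //; apply/funext => w;
    rewrite big_cons (negbTE Qi).
rewrite (_ : (fun w => _) = (fun w => f i w + \sum_(i <- r | Q i) f i w)).
  by apply: bounded_rvD => //; apply: bf.
by apply/funext => w; rewrite big_cons Qi.
Qed.

Lemma bounded_rv_prod (I : Type) (r : seq I) (Q : pred I) (f : I -> T -> R) :
  (forall i, Q i -> bounded_rv (f i)) -> bounded_rv (fun w => \prod_(i <- r | Q i) f i w).
Proof.
move=> bf; elim: r => [|i r IH].
  by rewrite (_ : (fun w => _) = cst 1); [exact: bounded_rv_cst|apply/funext => w; rewrite big_nil].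
case: (boolP (Q i)) => Qi; last first.
  by rewrite (_ : (fun w => _) = (fun w => \prod_(i <- r | Q i) f i w)) //; apply/funext => w;
    rewrite big_cons (negbTE Qi).
rewrite (_ : (fun w => _) = (fun w => f i w * \prod_(i <- r | Q i) f i w)).
  by apply: bounded_rvM => //; apply: bf.
by apply/funext => w; rewrite big_cons Qi.
Qed.

Lemma bounded_rv_indic (A : set T) : measurable A -> bounded_rv (\1_A : T -> R).
Proof.
move=> mA; split; first exact: measurable_indic.
by exists 1 => w; rewrite indicE normr_nat lern1; case: (_ \in _).
Qed.

Lemma Rexp_cst (c : R) : Rexp (fun=> c) = c.
Proof.
rewrite /Rexp Rintegral_cst //.
have -> : fine ((P : {measure set T -> \bar R}) setT) = 1 :> R.
  by rewrite [X in fine X](_ : _ = 1%:E) //; exact: probability_setT.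
by rewrite mulr1.
Qed.

Lemma RexpD f g : bounded_rv f -> bounded_rv g ->
  Rexp (fun w => f w + g w) = Rexp f + Rexp g.
Proof. by move=> bf bg; apply: RintegralD => //; apply: bounded_rv_integrable. Qed.

Lemma RexpZ (c : R) f : bounded_rv f -> Rexp (fun w => c * f w) = c * Rexp f.
Proof. by move=> bf; apply: RintegralZl => //; apply: bounded_rv_integrable. Qed.

Lemma RexpB f g : bounded_rv f -> bounded_rv g ->
  Rexp (fun w => f w - g w) = Rexp f - Rexp g.
Proof. by move=> bf bg; apply: RintegralB => //; apply: bounded_rv_integrable. Qed.

Lemma Rexp_sum (I : Type) (r : seq I) (Q : pred I) (f : I -> T -> R) :
  (forall i, Q i -> bounded_rv (f i)) ->
  Rexp (fun w => \sum_(i <- r | Q i) f i w) = \sum_(i <- r | Q i) Rexp (f i).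
Proof.
move=> bf; elim: r => [|i r IH].
  rewrite big_nil (_ : (fun w => _) = (fun=> 0)) ?Rexp_cst //.
  by apply/funext => w; rewrite big_nil.
rewrite big_cons; case: (boolP (Q i)) => Qi; last first.
  rewrite -IH; congr Rexp; apply/funext => w; by rewrite big_cons (negbTE Qi).
rewrite -IH -RexpD; [|exact: bf|exact: bounded_rv_sum].
by congr Rexp; apply/funext => w; rewrite big_cons Qi.
Qed.

Lemma Rexp_le f g : bounded_rv f -> bounded_rv g -> (forall w, f w <= g w) ->
  Rexp f <= Rexp g.
Proof.
by move=> bf bg fg; apply: le_Rintegral => //; apply: bounded_rv_integrable.
Qed.

Lemma normr_Rexp_le f C : bounded_rv f -> (forall w, `|f w| <= C) -> `|Rexp f| <= C.
Proof.
move=> bf fC; rewrite ler_norml; apply/andP; split.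
  rewrite -[leLHS]Rexp_cst; apply: Rexp_le => //; first exact: bounded_rv_cst.
  by move=> w; have := fC w; rewrite ler_norml => /andP[].
rewrite -[leRHS]Rexp_cst; apply: Rexp_le => //; first exact: bounded_rv_cst.
by move=> w; have := fC w; rewrite ler_norml => /andP[].
Qed.

Lemma Rexp_indic (A : set T) : measurable A -> Rexp \1_A = fine (P A).
Proof. by move=> mA; rewrite /Rexp /Rintegral integral_indic // setIT. Qed.

Lemma measurable_bounded_rv_ge f (c : R) : bounded_rv f ->
  measurable [set w | c <= f w].
Proof.
move=> [mf _]; rewrite (_ : [set w | _] = f @^-1` `[c, +oo[).
  by rewrite -[X in measurable X]setTI; apply: mf.
by apply/seteqP; split=> w /=; rewrite in_itv /= andbT.
Qed.

Lemma Rexp_markov f (c : R) : bounded_rv f -> (forall w, 0 <= f w) -> 0 < c ->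
  (P [set w | (c <= f w)%R] <= (Rexp f / c)%:E)%E.
Proof.
move=> bf f0 c0; set A := [set w | _].
have mA : measurable A by apply: measurable_bounded_rv_ge.
rewrite -(fineK (fin_num_measure P _ mA)) lee_fin ler_pdivlMr // -Rexp_indic // mulrC.
rewrite -RexpZ; last exact: bounded_rv_indic.
apply: Rexp_le => //; first by apply: bounded_rvZ; apply: bounded_rv_indic.
move=> w; rewrite indicE; case: (boolP (w \in A)) => [|_]; last by rewrite mulr0.
by rewrite inE mulr1.
Qed.

End BoundedExpectation.

(** * Expectations of products of independent variables *)

Section IndependentProduct.
Context d (T : measurableType d) (R : realType) (P : probability T R).

Definition adapted (G : set_system T) (f : T -> R) : Prop :=
  forall B, measurable B -> G (f @^-1` B).

Definition floor_level (f : T -> R) (C : R) (N : nat) (i : nat) : set T :=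
  f @^-1` `[i%:R / N%:R - C, i.+1%:R / N%:R - C[%classic.

(** [f] is rounded down to the grid of mesh 1/N that starts at -C. The levels are preimages of
    intervals, so the rounded function is built from events of any system to which [f] is
    adapted. *)
Lemma floor_approx (f : T -> R) (C : R) (N : nat) : (0 < N)%N ->
  (forall w, `|f w| <= C) -> exists m, forall w,
  `|f w - \sum_(i < m) (i%:R / N%:R - C) * \1_(floor_level f C N i) w| <= N%:R^-1.
Proof.
move=> N0 fC; exists (Num.truncn (2 * C * N%:R)).+1 => w.
have Np : 0 < N%:R :> R by rewrite ltr0n.
have /andP[f1 f2] : - C <= f w <= C by rewrite -ler_norml.
set h := (f w + C) * N%:R.
have h0 : 0 <= h by rewrite mulr_ge0 ?ler0n //; lra.
have hm : (Num.truncn h < (Num.truncn (2 * C * N%:R)).+1)%N.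
  by rewrite ltnS le_truncn // ler_wpM2r ?ler0n //; lra.
have lvl i : (w \in floor_level f C N i) = (i == Num.truncn h).
  rewrite [RHS]eq_sym truncn_eq //; apply/idP/idP.
    rewrite inE /floor_level /= in_itv /= lerBlDr ltrBrDr.
    by rewrite ler_pdivrMr // ltr_pdivlMr.
  move=> hh; rewrite inE /floor_level /= in_itv /= lerBlDr ltrBrDr.
  by rewrite ler_pdivrMr // ltr_pdivlMr.
rewrite (bigD1 (Ordinal hm)) //= big1 ?addr0 => [|i ih]; last first.
  rewrite indicE lvl (_ : (_ == _) = false) ?mulr0 //.
  by apply: contra_neqF ih => /eqP ih; apply/val_inj.
rewrite indicE lvl eqxx mulr1.
have /andP[] := truncn_itv h0; rewrite -natr1 => h1 h2.
have -> : f w - ((Num.truncn h)%:R / N%:R - C) = (h - (Num.truncn h)%:R) * N%:R^-1.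
  by rewrite /h; field; rewrite gt_eqF.
by rewrite ger0_norm ?mulr_ge0 ?subr_ge0 ?invr_ge0 ?ler0n // ler_piMl ?invr_ge0 ?ler0n //; lra.
Qed.

(** The last hypothesis is the case of an indicator. Linearity extends it to functions with values
    in a grid, and rounding [f] to mesh 1/N costs at most (D + |c|) / N, which [N] is chosen to keep
    below [e]. *)
Lemma Rexp_mul_indep (G : set_system T) (f g : T -> R) (c : R) :
  (forall A, G A -> measurable A) -> bounded_rv f -> adapted G f -> bounded_rv g ->
  (forall A, G A -> Rexp P (fun w => \1_A w * g w) = fine (P A) * c) ->
  Rexp P (fun w => f w * g w) = Rexp P f * c.
Proof.
move=> GT bf Gf bg hA; have [mf [C fC]] := bf; have [mg [D gD]] := bg.
have D0 : 0 <= D by apply: le_trans (gD point).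
apply/eqP; rewrite -subr_eq0 -normr_le0; apply/ler_addgt0Pl => e e0; rewrite addr0.
pose N := (Num.truncn ((D + `|c|) / e)).+1.
have N0 : (0 < N)%N by [].
have [m hm] := floor_approx N0 fC.
pose val i : R := i%:R / N%:R - C; pose A i := floor_level f C N i.
have GA i : G (A i) by apply: Gf; exact: measurable_itv.
pose u w := \sum_(i < m) val i * \1_(A i) w.
have bind i : bounded_rv (\1_(A i) : T -> R) by apply: bounded_rv_indic; apply: GT.
have bu : bounded_rv u by apply: bounded_rv_sum => i _; apply: bounded_rvZ.
have Eu : Rexp P u = \sum_(i < m) val i * fine (P (A i)).
  rewrite /u Rexp_sum => [|i _]; last exact: bounded_rvZ.
  by apply: eq_bigr => i _; rewrite RexpZ // Rexp_indic //; apply: GT.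
have Eug : Rexp P (fun w => u w * g w) = Rexp P u * c.
  rewrite Eu mulr_suml.
  rewrite (_ : (fun w => _) = (fun w => \sum_(i < m) val i * (\1_(A i) w * g w))).
    rewrite Rexp_sum => [|i _]; last by apply: bounded_rvZ; apply: bounded_rvM.
    by apply: eq_bigr => i _; rewrite RexpZ ?hA ?mulrA //; apply: bounded_rvM.
  by apply/funext => w; rewrite mulr_suml; apply: eq_bigr => i _; rewrite mulrA.
have bfu : bounded_rv (fun w => f w - u w).
  rewrite (_ : (fun w => _) = (fun w => f w + (-1) * u w)).
    by apply: bounded_rvD => //; apply: bounded_rvZ.
  by apply/funext => w; rewrite mulN1r.
have Efg : Rexp P (fun w => f w * g w) =
    Rexp P (fun w => (f w - u w) * g w) + Rexp P (fun w => u w * g w).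
  rewrite -RexpD; try exact: bounded_rvM.
  by congr Rexp; apply/funext => w; rewrite -mulrDl subrK.
have -> : Rexp P (fun w => f w * g w) - Rexp P f * c =
    Rexp P (fun w => (f w - u w) * g w) - Rexp P (fun w => f w - u w) * c.
  by rewrite Efg Eug (RexpB P bf bu); ring.
apply: le_trans (ler_normB _ _) _.
have h1 : `|Rexp P (fun w => (f w - u w) * g w)| <= N%:R^-1 * D.
  apply: normr_Rexp_le; first exact: bounded_rvM.
  by move=> w; rewrite normrM ler_pM //; apply: hm.
have h2 : `|Rexp P (fun w => f w - u w) * c| <= N%:R^-1 * `|c|.
  rewrite normrM ler_wpM2r //; apply: normr_Rexp_le => // w; exact: hm.
apply: le_trans (lerD h1 h2) _; rewrite -mulrDr mulrC ler_pdivrMr ?ltr0n //.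
by rewrite mulrC -ler_pdivrMr // ltW // truncnS_gt.
Qed.

Lemma Rexp_prod_indep (K : finType) (Dm : pred K) (G : K -> set_system T)
    (f : K -> T -> R) (J : {set K}) :
  mutually_independent P Dm G -> (forall k A, G k A -> measurable A) ->
  (forall k, k \in J -> Dm k) ->
  (forall k, k \in J -> bounded_rv (f k)) -> (forall k, k \in J -> adapted (G k) (f k)) ->
  Rexp P (fun w => \prod_(k in J) f k w) = \prod_(k in J) Rexp P (f k).
Proof.
move=> ind mG DJ.
(* Factors are traded for indicators one at a time: [s] lists the indices that may still carry a
   general adapted function. When it is empty, the claim is mutual independence itself. *)
suff main (s : seq K) : forall f : K -> T -> R, (forall k, k \in J -> bounded_rv (f k)) ->
  (forall k, k \in J -> (k \in s /\ adapted (G k) (f k)) \/ exists2 A, G k A & f k = \1_A) ->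
  Rexp P (fun w => \prod_(k in J) f k w) = \prod_(k in J) Rexp P (f k).
  move=> bf af; apply: (main (enum K)) => // k kJ; left; split; last exact: af.
  by rewrite mem_enum.
elim: s => [|k0 s IH] {}f bf af.
  have /choice[A hA] : forall k, exists A, k \in J -> G k A /\ f k = \1_A.
    move=> k; case: (boolP (k \in J)) => [kJ|_]; last by exists set0.
    by have [[]//|[A GA fA]] := af _ kJ; exists A.
  have mA k : k \in J -> measurable (A k) by move=> /hA[/mG].
  have -> : (fun w => \prod_(k in J) f k w) = \1_(\bigcap_(i in [set i | i \in J]) A i).
    apply/funext => w; rewrite indicE; case: (boolP (w \in _)) => [|hw].
      rewrite inE => hw; rewrite big1 // => k kJ; rewrite (proj2 (hA k kJ)) indicE.
      by rewrite mem_set //; apply: hw.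
    have [k kJ wk] : exists2 k, k \in J & w \notin A k.
      apply: contraNP hw => nk; rewrite inE => k /= kJ.
      by apply: contra_notP nk => wk; exists k => //; rewrite notin_setE.
    by rewrite (bigD1 k) //= (proj2 (hA k kJ)) indicE (negbTE wk) mul0r.
  rewrite Rexp_indic; last by apply: fin_bigcap_measurable => // k /= /mA.
  rewrite ind => [|k kJ]; last by split; [exact: DJ|case: (hA k kJ)].
  rewrite (eq_bigr (fun k => (fine (P (A k)))%:E)) => [|k kJ]; last first.
    by rewrite fineK // fin_num_measure //; apply: mA.
  rewrite prodEFin /=; apply: eq_bigr => k kJ.
  by rewrite (proj2 (hA k kJ)) Rexp_indic //; apply: mA.
have skip : (k0 \in J -> exists2 A, G k0 A & f k0 = \1_A) ->
    Rexp P (fun w => \prod_(k in J) f k w) = \prod_(k in J) Rexp P (f k).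
  move=> fA; apply: IH => // k kJ; have [[]|] := af k kJ; last by right.
  rewrite in_cons => /orP[/eqP kk|ks] ak; last by left.
  by right; rewrite kk in kJ *; apply: fA.
case: (boolP (k0 \in J)) => k0J; last by apply: skip => kJ; rewrite kJ in k0J.
have [[_ ak0]|h] := af k0 k0J; last by apply: skip.
rewrite [RHS](bigD1 k0) //=.
have -> : (fun w => \prod_(k in J) f k w) =
  (fun w => f k0 w * \prod_(k in J | k != k0) f k w).
  by apply/funext => w; rewrite (bigD1 k0).
apply: (@Rexp_mul_indep (G k0)) => //; [exact: mG|exact: bf| |].
  by apply: bounded_rv_prod => k /andP[kJ _]; apply: bf.
move=> A GA; pose f' k := if k == k0 then \1_A else f k.
have f'0 : f' k0 = \1_A by rewrite /f' eqxx.
have f'N k : k != k0 -> f' k = f k by rewrite /f' => /negbTE ->.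
have : Rexp P (fun w => \prod_(k in J) f' k w) = \prod_(k in J) Rexp P (f' k).
  apply: IH => k kJ; case: (eqVneq k k0) => [->|kk].
  - by rewrite f'0; apply: bounded_rv_indic; apply: mG GA.
  - by rewrite f'N //; apply: bf.
  - by right; exists A.
  - by rewrite f'N //; have [[]|] := af k kJ; [rewrite in_cons (negbTE kk); left|right].
rewrite [RHS](bigD1 k0) //= f'0 Rexp_indic; last exact: mG GA.
rewrite (eq_bigr (fun k => Rexp P (f k))) => [<-|]; last first.
  by move=> k /andP[_ kk]; rewrite f'N.
congr Rexp; apply/funext => w; rewrite [RHS](bigD1 k0) //= f'0; congr (_ * _).
by apply: eq_bigr => k /andP[_ kk]; rewrite f'N.
Qed.

End IndependentProduct.

(** * Independence of the entries seen through the observation mask *)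

Section MaskedProduct.
Context d (T : measurableType d) (R : realType) (P : probability T R).
Variables (m : sampling_model) (n : nat).
Variables (X : 'I_n -> 'I_n -> {RV P >-> R}) (O : 'I_n -> 'I_n -> {RV P >-> bool}).

Let idx (k : ('I_n * 'I_n) + ('I_n * 'I_n)) := match k with inl ij | inr ij => ij end.
Let G (k : ('I_n * 'I_n) + ('I_n * 'I_n)) : set_system T :=
  match k with
  | inl ij => sigma_of (X ij.1 ij.2)
  | inr ij => sigma_of (O ij.1 ij.2)
  end.

Hypothesis indep : mutually_independent P (fun k => match k with inl ij | inr ij =>
  free_entries m ij end) G.

Let G_measurable k A : G k A -> measurable A.
Proof.
by case: k => e [B mB <-]; apply: measurable_funP.
Qed.

Definition masked (phi : R -> R) (c : R) (e : 'I_n * 'I_n) (w : T) : R :=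
  if O e.1 e.2 w then phi (X e.1 e.2 w) else c.

Variables (phi : 'I_n * 'I_n -> R -> R) (c : 'I_n * 'I_n -> R).
Hypothesis phi_measurable : forall e, measurable_fun [set: R] (phi e).
Hypothesis phi_bounded : forall e, exists C : R, forall y, `|phi e y| <= C.

Let part (b : bool) (e : 'I_n * 'I_n) (w : T) : R :=
  if b then phi e (X e.1 e.2 w) else c e.
Let obs (b : bool) (e : 'I_n * 'I_n) (w : T) : R := (O e.1 e.2 w == b)%:R.

Let factor (beta : 'I_n * 'I_n -> bool) (k : ('I_n * 'I_n) + ('I_n * 'I_n)) : T -> R :=
  match k with inl e => part (beta e) e | inr e => obs (beta e) e end.

Let factor_bounded beta k : bounded_rv (factor beta k).
Proof.
case: k => e /=.
  rewrite /part; case: (beta e); last exact: bounded_rv_cst.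
  split; first exact: measurableT_comp.
  by have [C hC] := phi_bounded e; exists C => w.
split; last by exists 1 => w; rewrite normr_nat lern1; case: (_ == _).
have mb : measurable_fun [set: bool] (fun b : bool => (b == beta e)%:R : R) by [].
exact: (measurableT_comp mb).
Qed.

Let factor_adapted beta k : adapted (G k) (factor beta k).
Proof.
case: k => e B mB /=; rewrite /part /obs.
  case: (beta e).
    exists (phi e @^-1` B); last by rewrite setTI.
    by rewrite -[X in measurable X]setTI; apply: phi_measurable.
  exists (cst (c e) @^-1` B); last by rewrite setTI.
  by rewrite -[X in measurable X]setTI; apply: measurable_cst.
by exists ((fun b : bool => (b == beta e)%:R : R) @^-1` B); rewrite ?setTI.
Qed.

Let Rexp_prod_factor (J : {set 'I_n * 'I_n}) beta :
  (forall e, e \in J -> free_entries m e) ->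
  Rexp P (fun w => \prod_(e in J) (part (beta e) e w * obs (beta e) e w)) =
  \prod_(e in J) (Rexp P (part (beta e) e) * Rexp P (obs (beta e) e)).
Proof.
move=> JF; pose K := [set k | idx k \in J]%SET.
have e0 f : \prod_(k in K) f k = \prod_(e in J) (f (inl e) * f (inr e)) :> R.
  rewrite big_split /= big_sumType /=.
  by congr (_ * _); apply: eq_bigl => e; rewrite finset.inE.
rewrite -(e0 (fun k => Rexp P (factor beta k))).
rewrite -(Rexp_prod_indep (Dm := fun k => free_entries m (idx k)) (G := G)) //.
- by congr Rexp; apply/funext => w; rewrite (e0 (fun k => factor beta k w)).
- by move=> J' A h; apply: indep => k kJ; have := h k kJ; case: k {kJ}.
- by move=> k; rewrite finset.inE => /JF.
Qed.

Lemma bounded_rv_masked e : bounded_rv (masked (phi e) (c e) e).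
Proof.
rewrite (_ : masked _ _ _ = fun w => factor (fun=> true) (inl e) w * factor (fun=> true) (inr e) w +
  factor (fun=> false) (inl e) w * factor (fun=> false) (inr e) w).
  by apply: bounded_rvD; apply: bounded_rvM; apply: factor_bounded.
apply/funext => w; rewrite /masked /factor /part /obs.
by case: (O _ _ w); rewrite !(mulr1, mulr0, addr0, add0r).
Qed.

Let h b e w := part b e w * obs b e w.

Let h_bounded b e : bounded_rv (h b e).
Proof.
exact: (bounded_rvM (factor_bounded (fun=> b) (inl e)) (factor_bounded (fun=> b) (inr e))).
Qed.

Let maskedE e : masked (phi e) (c e) e = fun w => \sum_b h b e w.
Proof.
apply/funext => w; rewrite big_bool /h /masked /part /obs /=.
by case: (O _ _ w) => /=; rewrite !(mulr1, mulr0, addr0, add0r).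
Qed.

Let Rexp_h b e : free_entries m e ->
  Rexp P (h b e) = Rexp P (part b e) * Rexp P (obs b e).
Proof.
move=> fe; have := @Rexp_prod_factor [set e]%SET (fun=> b).
rewrite finset.big_set1 => <- => [|e']; last by rewrite finset.in_set1 => /eqP ->.
by congr Rexp; apply/funext => w; rewrite finset.big_set1.
Qed.

Lemma Rexp_masked e (q : R) : free_entries m e ->
  P [set w | O e.1 e.2 w = true] = q%:E ->
  Rexp P (masked (phi e) (c e) e) =
  q * Rexp P (fun w => phi e (X e.1 e.2 w)) + (1 - q) * c e.
Proof.
move=> fe Oq; set A := [set w | _] in Oq.
have mA : measurable A.
  have -> : A = O e.1 e.2 @^-1` [set true] by [].

  by rewrite -[X in measurable X]setTI; apply: measurable_funP.
have oT : obs true e = \1_A.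
  apply/funext => w; rewrite /obs indicE eqb_id; congr (nat_of_bool _)%:R.
  by apply/idP/idP => [Ow|]; [rewrite inE|rewrite inE].
have oF : obs false e = fun w => 1 - \1_A w.
  apply/funext => w; rewrite -oT /obs; by case: (O _ _ w) => /=; rewrite ?subrr ?subr0.
have bA : bounded_rv (\1_A : T -> R) by apply: bounded_rv_indic.
rewrite maskedE Rexp_sum // big_bool !Rexp_h //= /part oT oF.
by rewrite RexpB //;
  [rewrite !Rexp_cst Rexp_indic // Oq /= mulrC [c e * _]mulrC|exact: bounded_rv_cst].
Qed.

(** Independence is given for data and indicators as separate members of one family, while a masked
    entry depends on one of each. Splitting every factor by the value of its indicator gives a sum
    over observation patterns on [J]; each term is a product of functions of single members, so it
    factors, and the sum folds back. *)
Lemma Rexp_prod_masked (J : {set 'I_n * 'I_n}) :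
  (forall e, e \in J -> free_entries m e) ->
  Rexp P (fun w => \prod_(e in J) masked (phi e) (c e) e w) =
  \prod_(e in J) Rexp P (masked (phi e) (c e) e).
Proof.
move=> JF; transitivity (\prod_(e in J) \sum_b Rexp P (h b e)); last first.
  by apply: eq_bigr => e _; rewrite maskedE Rexp_sum.
rewrite (big_distr_big true).
rewrite (_ : (fun w => _) = fun w =>
   \sum_(f in pffun_on true (mem J) xpredT) \prod_(e in J) h (f e) e w); last first.
  apply/funext => w; transitivity (\prod_(e in J) \sum_b h b e w); last first.
    by rewrite (big_distr_big true).
  by apply: eq_bigr => e _; rewrite maskedE.
rewrite Rexp_sum => [|f _]; last by apply: bounded_rv_prod => e _.
apply: eq_bigr => f _; rewrite Rexp_prod_factor //.
by apply: eq_bigr => e eJ; rewrite Rexp_h ?JF.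
Qed.

End MaskedProduct.

(** * Trace moments of a random matrix as sums over walks *)

Section RandomMatrixMoments.
Context d (T : measurableType d) (R : realType) (P : probability T R).
Variables (E : finType) (N : nat) (edge : 'I_N -> 'I_N -> option E) (Z : E -> T -> R).

Definition edge_matrix (z : E -> R) : 'M[R]_N :=
  \matrix_(i, j) (if edge i j is Some e then z e else 0).

Let H w := edge_matrix (fun e => Z e w).

Hypothesis Z_bounded : forall e, bounded_rv (Z e).

(** Restricts the monomials to those that walks produce. In the symmetric model the positions below
    the diagonal are not edges, and independence is given only for the free positions. *)
Definition supported (mult : E -> nat) : Prop :=
  forall e, mult e != 0%N -> exists i j, edge i j = Some e.

Hypothesis Z_indep : forall mult : E -> nat, supported mult ->
  Rexp P (fun w => \prod_e Z e w ^+ mult e) = \prod_e Rexp P (fun w => Z e w ^+ mult e).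

Let bounded_prod (mult : E -> nat) : bounded_rv (fun w => \prod_e Z e w ^+ mult e).
Proof. by apply: bounded_rv_prod => e _; apply: bounded_rvX. Qed.

Lemma bounded_rv_edge_matrixX t c a : bounded_rv (fun w => (H w ^+ t) c a).
Proof.
elim: t c => [|t IH] c.
  by under eq_fun do rewrite expr0 mxE; exact: bounded_rv_cst.
rewrite (_ : (fun w => _) = fun w => \sum_j H w c j * (H w ^+ t) j a).
  apply: bounded_rv_sum => j _; apply: bounded_rvM => //.
  rewrite (_ : (fun w => _) = fun w => if edge c j is Some e then Z e w else 0).
    by case: (edge c j) => [e|]; [exact: Z_bounded|exact: bounded_rv_cst].
  by apply/funext => w; rewrite mxE.
by apply/funext => w; rewrite exprS -[_ * _]/(_ *m _) mxE.
Qed.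

Lemma bounded_rv_trace t : bounded_rv (fun w => \tr (H w ^+ t)).
Proof. by apply: bounded_rv_sum => a _; apply: bounded_rv_edge_matrixX. Qed.

(** Peeling one factor off H^t is one step of the walk: the entry used raises one exponent of the
    monomial in front. Independence enters only when no factor is left. *)
Lemma Rexp_edge_matrixX (t : nat) (mult : E -> nat) c a : supported mult ->
  Rexp P (fun w => (\prod_e Z e w ^+ mult e) * (H w ^+ t) c a) =
  walk_sum edge (fun e k => Rexp P (fun w => Z e w ^+ k)) a t mult c.
Proof.
elim: t mult c => [|t IH] mult c sm.
  rewrite /= -Z_indep // -RexpZ //; congr Rexp; apply/funext => w.
  by rewrite expr0 mxE mulrC.
have step j w : (\prod_e Z e w ^+ mult e) * (H w c j * (H w ^+ t) j a) =
    if edge c j is Some f then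
      (\prod_e Z e w ^+ incr_at f mult e) * (H w ^+ t) j a else 0.
  rewrite mxE; case: (edge c j) => [f|]; last by rewrite mul0r mulr0.
  rewrite mulrA; congr (_ * _); rewrite (bigD1 f) //= [in RHS](bigD1 f) //=.
  rewrite incr_atE exprSr mulrAC; congr (_ * _).
  by apply: eq_bigr => e ef; rewrite incr_at_neq.
rewrite (_ : (fun w => _) = fun w => \sum_j
    (\prod_e Z e w ^+ mult e) * (H w c j * (H w ^+ t) j a)); last first.
  by apply/funext => w; rewrite exprS -[H w * _]/(_ *m _) mxE mulr_sumr.
have Hb j : bounded_rv (fun w => H w c j).
  rewrite (_ : (fun w => _) = fun w => (H w ^+ 1) c j); first exact: bounded_rv_edge_matrixX.
  by apply/funext => w; rewrite expr1.
rewrite Rexp_sum => [|j _]; last first.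
  by apply: bounded_rvM => //; apply: bounded_rvM => //; apply: bounded_rv_edge_matrixX.
rewrite /=; apply: eq_bigr => j _.
rewrite (_ : (fun w => _) = fun w => if edge c j is Some f then
      (\prod_e Z e w ^+ incr_at f mult e) * (H w ^+ t) j a else 0); last exact/funext.
case cj: (edge c j) => [f|]; last by rewrite Rexp_cst.
apply: IH => e; case: (eqVneq e f) => [-> _|ef]; first by exists c, j.
by rewrite incr_at_neq //; apply: sm.
Qed.

Hypothesis edge_sym : forall i j, edge i j = edge j i.
Hypothesis edge_inj : forall i j k l e, edge i j = Some e -> edge k l = Some e ->
  (i = k /\ j = l) \/ (i = l /\ j = k).
Variables (v : E -> R) (B s : R).
Hypotheses (v_ge0 : forall e, 0 <= v e) (B_ge0 : 0 <= B) (s_gt0 : 0 < s).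
Hypothesis Z_le : forall e w, `|Z e w| <= B.
Hypothesis Z_mean : forall e, Rexp P (Z e) = 0.
Hypothesis Z_var : forall e, Rexp P (fun w => Z e w ^+ 2) <= v e.
Hypothesis row_var_le : forall c,
  \sum_j (if edge c j is Some e then v e else 0) <= s ^+ 2.

Lemma Rexp_trace_le t :
  Rexp P (fun w => \tr (H w ^+ t)) <= N%:R * (2 * s + B * t.+1%:R ^+ 2) ^+ t.
Proof.
rewrite Rexp_sum => [|a _]; last exact: bounded_rv_edge_matrixX.
apply: le_trans (_ : \sum_(a < N) (2 * s + B * t.+1%:R ^+ 2) ^+ t <= _); last first.
  by rewrite sumr_const card_ord [N%:R * _]mulr_natl.
apply: ler_sum => a _.
have -> : Rexp P (fun w => (H w ^+ t) a a) =
    walk_sum edge (fun e k => Rexp P (fun w => Z e w ^+ k)) a t (fun=> 0%N) a.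
  rewrite -Rexp_edge_matrixX //; congr Rexp; apply/funext => w.
  by rewrite big1 ?mul1r // => e _; rewrite expr0.
apply: le_trans (ler_norm _) _.
apply: (@closed_walk_sum_le R _ E edge _ v B s a t) => //.
- move=> e k; apply: normr_Rexp_le; first exact: bounded_rvX.
  by move=> w; rewrite normrX lerXn2r ?nnegrE.
- move=> e k k2; set f := fun w => _.
  have bf : bounded_rv f by apply: bounded_rvX.
  have bZ2 : bounded_rv (fun w => B ^+ (k - 2) * Z e w ^+ 2).
    by apply: bounded_rvZ; apply: bounded_rvX.
  have fle w : `|f w| <= B ^+ (k - 2) * Z e w ^+ 2.
    rewrite /f normrX -(subnK k2) exprD -[Z e w ^+ 2]real_normK ?num_real //.
    by rewrite ler_wpM2r ?exprn_ge0 // addnK lerXn2r ?nnegrE.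
  apply: le_trans (_ : Rexp P (fun w => B ^+ (k - 2) * Z e w ^+ 2) <= _).
    rewrite ler_norml; apply/andP; split; last first.
      by apply: Rexp_le => // w; apply: le_trans (ler_norm _) (fle w).
    rewrite -mulN1r -RexpZ //; apply: Rexp_le => //; first exact: bounded_rvZ.
    by move=> w; rewrite mulN1r; have := fle w; rewrite ler_norml => /andP[].
  rewrite RexpZ; last exact: bounded_rvX.
  by rewrite [leRHS]mulrC; apply: ler_wpM2l; rewrite ?exprn_ge0.
Qed.

Lemma trace_tail_le (k : nat) (tau : R) : 0 < tau ->
  (P [set w | (tau ^+ k.+1 <= \tr (H w ^+ (k.+1).*2))%R] <=
   (N%:R * (2 * s + B * ((k.+1).*2).+1%:R ^+ 2) ^+ (k.+1).*2 / tau ^+ k.+1)%:E)%E.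
Proof.
move=> tau0; have Hs w : (H w)^T = H w.
  by apply/matrixP => i j; rewrite !mxE edge_sym.
apply: le_trans (Rexp_markov P (bounded_rv_trace _) _ _) _.
- move=> w; rewrite -addnn exprD.
  suff HX j : (H w ^+ j)^T = H w ^+ j by rewrite -{2}HX -[_ * _]/(_ *m _) -sqnorm_tr sqnorm_ge0.
  elim: j => [|j IH]; first by rewrite expr0 trmx1.
  by rewrite exprS -[H w * _]/(_ *m _) trmx_mul IH Hs -[_ *m _]/(_ * _) -exprSr exprS.
- by rewrite exprn_gt0.
by rewrite lee_fin ler_wpM2r ?invr_ge0 ?exprn_ge0 ?(ltW tau0) // Rexp_trace_le.
Qed.

End RandomMatrixMoments.

(** * The noise and the observed proportion *)

Section NoiseNorm.
Variable R : realType.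

(* The data are bounded by 1 only almost surely; moments are computed for the
   clipped entries, which are bounded everywhere. *)
Definition clip (y : R) : R := y * \1_(`[-1, 1]%classic : set R) y.

Lemma clip_id (y : R) : `|y| <= 1 -> clip y = y.
Proof.
by rewrite ler_norml => y1; rewrite /clip indicE mem_set ?mulr1 //= in_itv.
Qed.

Lemma normr_clip_le (y : R) : `|clip y| <= 1.
Proof.
rewrite /clip indicE; case: (boolP (y \in _)) => [|_]; last by rewrite mulr0 normr0.
by rewrite inE /= in_itv /= mulr1 ler_norml.
Qed.

Lemma measurable_clip : measurable_fun [set: R] clip.
Proof.
apply: measurable_funM; first exact: measurable_id.
by apply: measurable_indic; apply: measurable_itv.
Qed.

Context d (T : measurableType d) (P : probability T R).
Variables (m : sampling_model) (n : nat) (M : 'M[R]_n) (p : R).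
Variables (X : 'I_n -> 'I_n -> {RV P >-> R}) (O : 'I_n -> 'I_n -> {RV P >-> bool}).
Hypothesis dm : data_model m M p X O.
Hypothesis M_le : forall i j, `|M i j| <= 1.
Hypotheses (p_gt0 : 0 < p) (p_le1 : p <= 1) (n_gt0 : (0 < n)%N).

Lemma Rexp_clip i j : Rexp P (fun w => clip (X i j w)) = M i j.
Proof.
have h := data_mean dm i j; rewrite unlock in h.
rewrite /Rexp /Rintegral -[RHS]/(fine (M i j)%:E) -h; congr fine.
apply: ae_eq_integral => //.
- by apply/measurable_EFinP; apply: measurableT_comp measurable_clip _.
- exact/measurable_EFinP.
- have := data_bounded dm i j; apply: filterS => w X1 _ /=.
  by rewrite clip_id.
Qed.

Let phi (e : 'I_n * 'I_n) (y : R) : R := clip y - p * M e.1 e.2.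
Let cst0 (e : 'I_n * 'I_n) : R := - (p * M e.1 e.2).

Definition noise_entry (e : 'I_n * 'I_n) (w : T) : R :=
  if free_entries m e then masked X O (phi e) (cst0 e) e w else 0.

Let pM_le e : `|p * M e.1 e.2| <= 1.
Proof. by rewrite normrM -[1]mulr1 ler_pM // ger0_norm // ltW. Qed.

Let phi_le e y : `|phi e y| <= 2.
Proof. by apply: le_trans (ler_normB _ _) _; rewrite (_ : 2 = 1 + 1) // lerD ?normr_clip_le. Qed.

Let phiX_measurable k e : measurable_fun [set: R] (fun y => phi e y ^+ k).
Proof.
apply: measurable_funX; apply: measurable_funD; first exact: measurable_clip.
exact: measurable_cst.
Qed.

Let phiX_bounded k e : exists C : R, forall y, `|phi e y ^+ k| <= C.
Proof. by exists (2 ^+ k) => y; rewrite normrX lerXn2r ?nnegrE. Qed.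

Lemma noise_entry_le e w : `|noise_entry e w| <= 2.
Proof.
rewrite /noise_entry /masked; case: ifP => _; last by rewrite normr0.
case: ifP => _; first exact: phi_le.
by rewrite normrN; apply: le_trans (pM_le _) _; rewrite ler1n.
Qed.

Let noise_entryX k e w : free_entries m e -> noise_entry e w ^+ k =
  masked X O (fun y => phi e y ^+ k) (cst0 e ^+ k) e w.
Proof. by move=> fe; rewrite /noise_entry fe /masked; case: ifP. Qed.

Lemma noise_entry_bounded e : bounded_rv (noise_entry e).
Proof.
case: (boolP (free_entries m e)) => fe; last first.
  by rewrite /noise_entry (negbTE fe); exact: bounded_rv_cst.
rewrite (_ : noise_entry e = masked X O (fun y => phi e y ^+ 1) (cst0 e ^+ 1) e).
  exact: (bounded_rv_masked X O (fun e => cst0 e ^+ 1) (phiX_measurable 1) (phiX_bounded 1)).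
by apply/funext => w; rewrite -noise_entryX.
Qed.

Let Rexp_noise_entryX k e : free_entries m e -> Rexp P (fun w => noise_entry e w ^+ k) =
  p * Rexp P (fun w => phi e (X e.1 e.2 w) ^+ k) + (1 - p) * cst0 e ^+ k.
Proof.
move=> fe; rewrite -(Rexp_masked (data_independent dm) (fun e => cst0 e ^+ k)
  (phiX_measurable k) (phiX_bounded k) fe (data_observed dm _ _)).
by congr Rexp; apply/funext => w; rewrite noise_entryX.
Qed.

Let bounded_clip i j : bounded_rv (fun w => clip (X i j w)).
Proof.
split; first exact: measurableT_comp measurable_clip _.
by exists 1 => w; apply: normr_clip_le.
Qed.

Lemma noise_entry_mean e : Rexp P (noise_entry e) = 0.
Proof.
case: (boolP (free_entries m e)) => fe; last first.
  by rewrite /noise_entry (negbTE fe) Rexp_cst.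
have := Rexp_noise_entryX 1 fe; rewrite /phi expr1 /cst0 => h.
rewrite [LHS]h RexpB ?Rexp_cst ?Rexp_clip; [|exact: bounded_clip|exact: bounded_rv_cst].
by ring.
Qed.

(** For a free entry the second moment equals p E[clip^2] - (p M)^2, because the clipped entry has
    mean [M]; the first term is at most [p]. *)
Lemma noise_entry_var_le e : Rexp P (fun w => noise_entry e w ^+ 2) <= p.
Proof.
case: (boolP (free_entries m e)) => fe; last first.
  rewrite /noise_entry (negbTE fe) (_ : (fun w => _) = fun=> 0) ?Rexp_cst ?ltW //.
  by apply/funext => w; rewrite expr0n.
rewrite Rexp_noise_entryX // /cst0 /phi; set q := p * M e.1 e.2.
have bc := bounded_clip e.1 e.2; have bc2 := bounded_rvX 2 bc.
have -> : Rexp P (fun w => (clip (X e.1 e.2 w) - q) ^+ 2) =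
    Rexp P (fun w => clip (X e.1 e.2 w) ^+ 2) + (- (2 * q) * M e.1 e.2 + q ^+ 2).
  rewrite (_ : (fun w => _) = fun w => clip (X e.1 e.2 w) ^+ 2 +
      (- (2 * q) * clip (X e.1 e.2 w) + q ^+ 2)); last by apply/funext => w; ring.
  have b1 := bounded_rvZ (- (2 * q)) bc.
  have b2 := bounded_rv_cst T (q ^+ 2).
  rewrite (RexpD P bc2 (bounded_rvD b1 b2)) (RexpD P b1 b2) (RexpZ P _ bc).
  by rewrite Rexp_clip Rexp_cst.
have h1 : Rexp P (fun w => clip (X e.1 e.2 w) ^+ 2) <= 1.
  rewrite -[leRHS](Rexp_cst P); apply: Rexp_le => //; first exact: bounded_rv_cst.
  move=> w; rewrite -real_normK ?num_real // expr_le1 //; exact: normr_clip_le.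
have -> : p * (Rexp P (fun w => clip (X e.1 e.2 w) ^+ 2) + (- (2 * q) * M e.1 e.2 + q ^+ 2)) +
   (1 - p) * (- q) ^+ 2 = p * Rexp P (fun w => clip (X e.1 e.2 w) ^+ 2) - q ^+ 2.
  by rewrite /q; ring.
have := ler_wpM2l (ltW p_gt0) h1; rewrite mulr1 => h2.
by have := sqr_ge0 q; lra.
Qed.

Lemma noise_entry_indep (mult : 'I_n * 'I_n -> nat) :
  (forall e, mult e != 0%N -> free_entries m e) ->
  Rexp P (fun w => \prod_e noise_entry e w ^+ mult e) =
  \prod_e Rexp P (fun w => noise_entry e w ^+ mult e).
Proof.
move=> hm; pose J := [set e | mult e != 0%N]%SET.
have JF e : e \in J -> free_entries m e by rewrite finset.inE; apply: hm.
have prodJ (F : 'I_n * 'I_n -> R) : (forall e, e \notin J -> F e = 1) ->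
    \prod_e F e = \prod_(e in J) F e.
  by move=> F1; rewrite [RHS]big_mkcond; apply: eq_bigr => e _; case: ifPn => // /F1.
have m0 e : e \notin J -> mult e = 0%N by rewrite finset.inE negbK => /eqP.
rewrite [RHS]prodJ => [|e /m0 ->]; last first.
  by rewrite (_ : (fun w => _) = fun=> 1) ?Rexp_cst //; apply/funext => w; rewrite expr0.
transitivity (\prod_(e in J) Rexp P (masked X O (fun y => phi e y ^+ mult e) (cst0 e ^+ mult e) e)).
  rewrite -(Rexp_prod_masked (data_independent dm) (phi := fun e y => phi e y ^+ mult e)
   (fun e => cst0 e ^+ mult e) (fun e => phiX_measurable _ e) (fun e => phiX_bounded _ e)) //.
  congr Rexp; apply/funext => w; rewrite prodJ => [|e /m0 ->]; last by rewrite expr0.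
  by apply: eq_bigr => e /JF fe; rewrite noise_entryX.
apply: eq_bigr => e /JF fe; congr Rexp; apply/funext => w.
by rewrite noise_entryX.
Qed.

Definition noise_matrix (w : T) : 'M[R]_n :=
  observed_matrix (fun i j => clip (X i j w)) (fun i j => O i j w) - p *: M.

Let noise_matrixE w i j : noise_matrix w i j =
  masked X O (phi (i, j)) (cst0 (i, j)) (i, j) w.
Proof.
by rewrite !mxE /masked /phi /cst0 /=; case: ifP => _; rewrite ?sub0r.
Qed.

Let noise_bound (k : nat) (tau : R) : R :=
  (2 * n)%:R * (2 * Num.sqrt (n%:R * p) + 2 * ((k.+1).*2).+1%:R ^+ 2) ^+ (k.+1).*2 / tau ^+ k.+1.

(** The part common to both models. A degree at most [n] and variance [p] per edge give row
    variances at most np, and [eH] carries the norm bound from the matrix of the graph back to the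
    noise. *)
Let noise_tail_edge (N : nat) (edge : 'I_N -> 'I_N -> option ('I_n * 'I_n)) (k : nat) (tau : R) :
  0 < tau -> (N <= 2 * n)%N ->
  (forall i j, edge i j = edge j i) ->
  (forall i j k l e, edge i j = Some e -> edge k l = Some e ->
    (i = k /\ j = l) \/ (i = l /\ j = k)) ->
  (forall i j e, edge i j = Some e -> free_entries m e) ->
  (forall c, (\sum_j (edge c j : bool) <= n)%N) ->
  (forall w, opnorm2_le tau (edge_matrix edge (fun e => noise_entry e w)) ->
     opnorm2_le tau (noise_matrix w)) ->
  exists A, [/\ measurable A, (P A <= (noise_bound k tau)%:E)%E &
    forall w, ~ A w -> opnorm2_le tau (noise_matrix w)].
Proof.
move=> tau0 N2 es ei ef er eH.
have np0 : 0 < n%:R * p by rewrite mulr_gt0 // ltr0n.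
have indep (mult : 'I_n * 'I_n -> nat) : supported edge mult ->
    Rexp P (fun w => \prod_e noise_entry e w ^+ mult e) =
    \prod_e Rexp P (fun w => noise_entry e w ^+ mult e).
  by move=> hm; apply: noise_entry_indep => e /hm [i [j /ef]].
exists [set w | tau ^+ k.+1 <= \tr (edge_matrix edge (fun e => noise_entry e w) ^+ (k.+1).*2)].
split.
- apply: measurable_bounded_rv_ge; apply: bounded_rv_trace; exact: noise_entry_bounded.
- have s0 : 0 < Num.sqrt (n%:R * p) by rewrite sqrtr_gt0.
  apply: le_trans (trace_tail_le noise_entry_bounded indep es ei (fun=> ltW p_gt0) _ s0
     noise_entry_le noise_entry_mean noise_entry_var_le _ k tau0) _ => [//|c|].
    rewrite sqr_sqrtr ?(ltW np0) //.
    rewrite (eq_bigr (fun j => (edge c j : bool)%:R * p)) => [|j _]; last first.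
      by case: (edge c j) => [e|] /=; rewrite ?mul1r ?mul0r.
    by rewrite -mulr_suml -natr_sum ler_wpM2r ?ler_nat ?(ltW p_gt0).
  rewrite lee_fin /noise_bound; apply: ler_wpM2r.
    by rewrite invr_ge0 exprn_ge0 // ltW.
  apply: ler_wpM2r; last by rewrite ler_nat.
  by rewrite exprn_ge0 // addr_ge0 // mulr_ge0 ?exprn_ge0 // sqrtr_ge0.
- move=> w nA; apply: eH; apply: (@opnorm2_le_trace_power _ _ _ k) => //.
  + by apply/matrixP => i j; rewrite !mxE es.
  + exact: ltW.
  + by rewrite leNgt; apply/negP => h; apply: nA; apply: ltW.
Qed.

Lemma noise_opnorm_tail (k : nat) (tau : R) : 0 < tau ->
  exists A, [/\ measurable A,
    (P A <= ((2 * n)%:R * (2 * Num.sqrt (n%:R * p) +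
       2 * ((k.+1).*2).+1%:R ^+ 2) ^+ (k.+1).*2 / tau ^+ k.+1)%:E)%E &
    forall w, ~ A w -> opnorm2_le tau (noise_matrix w)].
Proof.
move=> tau0; case em : m.
  (* The walks of the asymmetric model live on the bipartite graph of rows and
     columns: the noise is replaced by its self-adjoint dilation. *)
  pose edge (i j : 'I_(n + n)) := match fintype.split i, fintype.split j with
    | inl a, inr b => Some (a, b) | inr b, inl a => Some (a, b) | _, _ => None end.
  apply: (@noise_tail_edge _ edge) => //.
  - by rewrite mul2n addnn.
  - by move=> i j; rewrite /edge; case: (fintype.split i) (fintype.split j) => a [] b.
  - move=> i j k' l e; rewrite /edge.
    case: (splitP i) (splitP j) (splitP k') (splitP l) => a ia [] b jb [] a' ka [] b' lb //=
      [<-] [] ? ?; subst.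
    + by left; split; apply/val_inj; rewrite /= ?ia ?ka ?jb ?lb.
    + by right; split; apply/val_inj; rewrite /= ?ia ?ka ?jb ?lb.
    + by right; split; apply/val_inj; rewrite /= ?ia ?ka ?jb ?lb.
    + by left; split; apply/val_inj; rewrite /= ?ia ?ka ?jb ?lb.
  - by move=> i j e _; rewrite em.
  - move=> c; rewrite big_split_ord /= /edge; case: (fintype.split c) => a.
      rewrite big1 => [|j _]; last by rewrite (unsplitK (inl j : 'I_n + 'I_n)%type).
      rewrite add0n (eq_bigr (fun=> 1%N)) ?sum1_card ?card_ord // => j _.
      by rewrite (unsplitK (inr j : 'I_n + 'I_n)%type).
    rewrite [X in (_ + X)%N]big1 => [|j _]; last by rewrite (unsplitK (inr j : 'I_n + 'I_n)%type).
    rewrite addn0 (eq_bigr (fun=> 1%N)) ?sum1_card ?card_ord // => j _.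
    by rewrite (unsplitK (inl j : 'I_n + 'I_n)%type).
  - move=> w h; apply: opnorm2_le_block; move: h.
    rewrite (_ : edge_matrix _ _ = block_mx 0 (noise_matrix w) (noise_matrix w)^T 0) //.
    move: (noise_matrix w) (noise_matrixE w) => D DE.
    apply/matrixP => i j; rewrite !mxE /edge.
    case: (fintype.split i) => a; rewrite mxE; case: (fintype.split j) => b; rewrite ?mxE //.
      by rewrite DE /noise_entry em.
    by rewrite DE /noise_entry em.
(* In the symmetric model the noise is already self-adjoint: the graph is complete on [n] vertices
   with loops, and an edge is named by its position on or above the diagonal. *)
pose edge (i j : 'I_n) := Some (if (i <= j)%N then (i, j) else (j, i)).
apply: (@noise_tail_edge _ edge) => //.
- by rewrite leq_pmull.
- by move=> i j; rewrite /edge; case: ltngtP => // /val_inj ->.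
- move=> i j k' l e [<-] [].
  by case: ifP => _; case: ifP => _ [-> ->]; [left|right|right|left].
- by move=> i j e [<-]; rewrite em /=; case: (leqP i j) => // /ltnW.
- by move=> c; rewrite sum1_card card_ord.
- move=> w; rewrite (_ : edge_matrix _ _ = noise_matrix w) //.
  apply/matrixP => i j; rewrite mxE /edge noise_matrixE /noise_entry em /=.
  have Ms : M i j = M j i.
    have e1 := data_mean dm i j; have e2 := data_mean dm j i.
    move: e1; rewrite (_ : X i j = X j i :> (T -> R)); first by rewrite e2 => -[].
    by apply/funext => w'; apply: (data_symmetric dm em).
  case: (leqP i j) => [ij|/ltnW ji] /=; first by rewrite ij.
  by rewrite ji /masked /phi /cst0 /= Ms (data_symmetric dm em i j) (observed_symmetric dm em i j).
Qed.

End NoiseNorm.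

(** * Concentration of the observed proportion *)

Section ObservedProportion.
Context d (T : measurableType d) (R : realType) (P : probability T R).
Variables (m : sampling_model) (n : nat) (M : 'M[R]_n) (p : R).
Variables (X : 'I_n -> 'I_n -> {RV P >-> R}) (O : 'I_n -> 'I_n -> {RV P >-> bool}).
Hypothesis dm : data_model m M p X O.
Hypotheses (p_gt0 : 0 < p) (n_gt0 : (0 < n)%N).

(** Of (i, j) and (j, i) at least one is free, so the free positions and their transposes cover the
    whole square. *)
Lemma card_free_entries_ge : (n ^ 2 <= 2 * #|free_entries m (n := n)|)%N.
Proof.
have cE (Q : pred ('I_n * 'I_n)) : #|Q| = (\sum_i \sum_j Q (i, j))%N.
  by rewrite -sum1_card big_mkcond /= pair_bigA; apply: eq_bigr => -[i j] _.
rewrite -mulnn mul2n -addnn {1 2}cE.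
have -> : (n * n = \sum_(i < n) \sum_(j < n) 1)%N.
  by rewrite !sum_nat_const card_ord muln1.
rewrite [X in (_ <= _ + X)%N]exchange_big -big_split /=; apply: leq_sum => i _.
rewrite -big_split /=; apply: leq_sum => j _.
by case: m => //=; case: (leqP i j) => // /ltnW ->.
Qed.

Let F : R := #|free_entries m (n := n)|%:R.

Let F_gt0 : 0 < F.
Proof.
rewrite ltr0n; have := card_free_entries_ge; case: #|_| => // /[!muln0].
by rewrite leqn0 expn_eq0 /= eqn0Ngt n_gt0.
Qed.

(** The centred observation indicator, written as a masked entry with constant data so that the
    product formula for masked entries applies to it. *)
Let xi (e : 'I_n * 'I_n) (w : T) : R := masked X O (fun=> 1 - p) (- p) e w.

Let xi_bounded e : bounded_rv (xi e).
Proof.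
apply: (bounded_rv_masked X O (phi := fun=> fun=> 1 - p) (fun=> - p)) => _.
  exact: measurable_cst.
by exists `|1 - p|.
Qed.

Let Rexp_masked_cst (a b : R) e : free_entries m e ->
  Rexp P (masked X O (fun=> a) b e) = p * a + (1 - p) * b.
Proof.
move=> fe; rewrite (Rexp_masked (data_independent dm) (phi := fun=> fun=> a) (fun=> b)
  _ _ fe (data_observed dm _ _)); first by rewrite Rexp_cst.
  by move=> _; apply: measurable_cst.
by move=> _; exists `|a|.
Qed.

Let bounded_const (a : R) : exists C : R, forall y : R, `|(fun=> a) y| <= C.
Proof. by exists `|a|. Qed.

Let xi_indep e f : free_entries m e -> free_entries m f -> e != f ->
  Rexp P (fun w => xi e w * xi f w) = 0.
Proof.
move=> fe ff ef.
have e2 (h : 'I_n * 'I_n -> R) : \prod_(k in [set e; f]%SET) h k = h e * h f.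
  by rewrite finset.big_setU1 ?finset.big_set1 // finset.in_set1.
have := Rexp_prod_masked (data_independent dm) (phi := fun=> fun=> 1 - p) (fun=> - p)
  (fun=> measurable_cst _) (fun=> bounded_const _) (J := [set e; f]%SET).
rewrite e2 !Rexp_masked_cst // (_ : p * (1 - p) + (1 - p) * - p = 0) ?mul0r; last by ring.
move=> <- => [|k]; last by rewrite !finset.inE => /orP[] /eqP ->.
by congr Rexp; apply/funext => w; rewrite e2.
Qed.

Let xi_var e : free_entries m e -> Rexp P (fun w => xi e w ^+ 2) <= p.
Proof.
move=> fe; rewrite (_ : (fun w => _) = masked X O (fun=> (1 - p) ^+ 2) ((- p) ^+ 2) e).
  rewrite Rexp_masked_cst //; have := sqr_ge0 p.
  have -> : p * (1 - p) ^+ 2 + (1 - p) * (- p) ^+ 2 = p - p ^+ 2 by ring.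
  lra.
by apply/funext => w; rewrite /xi /masked; case: ifP.
Qed.

Let phat (w : T) : R := observed_proportion m (fun i j => O i j w).

Let phatE w : phat w - p = F^-1 * \sum_(e | free_entries m e) xi e w.
Proof.
have -> : \sum_(e | free_entries m e) xi e w = \sum_(e | free_entries m e) ((O e.1 e.2 w)%:R - p).
  apply: eq_bigr => e _; rewrite /xi /masked; case: (O _ _ w) => //.
  by rewrite sub0r.
rewrite sumrB sumr_const -natr_sum -/F.
have -> : (\sum_(e | free_entries m e) O e.1 e.2 w)%N =
    #|[pred ij | free_entries m ij && O ij.1 ij.2 w]|.
  by rewrite -sum1_card [RHS]big_mkcondr; apply: eq_bigr => e _; case: (O _ _ w).
by rewrite mulrBr -[p *+ _]mulr_natl mulKf ?gt_eqF // mulrC.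
Qed.

Lemma Rexp_sqr_observed_proportion_le :
  Rexp P (fun w => (phat w - p) ^+ 2) <= p / F.
Proof.
rewrite (_ : (fun w => _) = fun w => F ^- 2 * \sum_(e | free_entries m e)
    \sum_(f | free_entries m f) xi e w * xi f w); last first.
  apply/funext => w; rewrite phatE exprMn -exprVn; congr (_ * _).
  by rewrite expr2 mulr_suml; apply: eq_bigr => e _; rewrite mulr_sumr.
have bxi e f : bounded_rv (fun w => xi e w * xi f w) by apply: bounded_rvM.
have bs e : bounded_rv (fun w => \sum_(f | free_entries m f) xi e w * xi f w).
  by apply: bounded_rv_sum => f _.
rewrite RexpZ; last by apply: bounded_rv_sum => e _.
rewrite Rexp_sum //; apply: le_trans (_ : F ^- 2 * (p * F) <= _); last first.
  rewrite expr2 invfM mulrCA; apply: ler_wpM2l; first exact: ltW.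
  by rewrite -mulrA mulVf ?mulr1 // gt_eqF.
apply: ler_wpM2l; first by rewrite invr_ge0 exprn_ge0 // ltW.
apply: le_trans (_ : \sum_(e : 'I_n * 'I_n | free_entries m e) p <= _); last first.
  by rewrite sumr_const /F mulr_natr.
apply: ler_sum => e fe; rewrite Rexp_sum // (bigD1 e) //= big1 ?addr0 => [|f /andP[ff fne]].
  by apply: le_trans (xi_var fe).
by rewrite xi_indep // eq_sym.
Qed.

(** Chebyshev at relative precision kap / sqrt(n). This precision makes (phat - p)^2 times the
    squared norm of [M], which is at most n^2, no larger than order np, the order of the noise per
    unit of rank. *)
Lemma observed_proportion_tail (kap : R) : 0 < kap ->
  exists A, [/\ measurable A, (P A <= (2 / (kap ^+ 2 * (n%:R * p)))%:E)%E &
    forall w, ~ A w -> (phat w - p) ^+ 2 <= kap ^+ 2 * p ^+ 2 / n%:R].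
Proof.
move=> kap0; have np : 0 < n%:R :> R by rewrite ltr0n.
have b0 : 0 < kap ^+ 2 * p ^+ 2 / n%:R by rewrite divr_gt0 // mulr_gt0 // exprn_gt0.
have bp : bounded_rv (fun w => (phat w - p) ^+ 2).
  apply: bounded_rvX; rewrite (_ : (fun w => _) = fun w =>
    F^-1 * \sum_(e | free_entries m e) xi e w); last by apply/funext => w; rewrite phatE.
  by apply: bounded_rvZ; apply: bounded_rv_sum.
exists [set w | kap ^+ 2 * p ^+ 2 / n%:R <= (phat w - p) ^+ 2]; split.
- exact: measurable_bounded_rv_ge.
- apply: le_trans (Rexp_markov P bp (fun w => sqr_ge0 _) b0) _; rewrite lee_fin.
  rewrite ler_pdivrMr //; apply: le_trans Rexp_sqr_observed_proportion_le _.
  have -> : 2 / (kap ^+ 2 * (n%:R * p)) * (kap ^+ 2 * p ^+ 2 / n%:R) = p * (2 / n%:R ^+ 2).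
    by field; rewrite !gt_eqF.
  apply: ler_wpM2l; first exact: ltW.
  rewrite ler_pdivlMr ?exprn_gt0 // mulrC ler_pdivrMr // -natrX -natrM ler_nat.
  exact: card_free_entries_ge.
- by move=> w h; apply/ltW; rewrite ltNge; apply/negP.
Qed.

End ObservedProportion.

(** * Deterministic error bound on the good event *)

Section UsvtError.
Variables (R : realType) (n : nat).

Lemma orthonormal_family_matrix (u : 'I_n -> 'cV[R]_n) : orthonormal_family u ->
  let U := \matrix_(i, j) u i j 0 : 'M[R]_n in U *m U^T = 1%:M.
Proof.
move=> ou; apply/matrixP => i j; have /matrixP/(_ 0 0) := ou i j.
rewrite !mxE eqxx mulr1n => <-; apply: eq_bigr => l _; by rewrite !mxE.
Qed.

Lemma sum_rank_one_matrix (s : 'I_n -> R) (u v : 'I_n -> 'cV[R]_n) (S : pred 'I_n) :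
  \sum_(i | S i) s i *: (u i *m (v i)^T) =
  (\matrix_(i, j) u i j 0)^T *m
    (\matrix_(i, j) (if S i then s i * (\matrix_(i, j) v i j 0 : 'M[R]_n) i j else 0)).
Proof.
apply/matrixP => a b; rewrite summxE !mxE big_mkcond; apply: eq_bigr => i _.
rewrite !mxE big_ord1 !mxE; case: ifP => _; last by rewrite mulr0.
by rewrite mulrCA.
Qed.

(** Truncation picks the point of [-1, 1] nearest to [w], and [a] lies in that interval. *)
Lemma truncate_sqr_le (w a : R) : `|a| <= 1 -> (truncate w - a) ^+ 2 <= (w - a) ^+ 2.
Proof.
rewrite ler_norml => /andP[a1 a2]; rewrite /truncate.
case: ltP => [w1|_].
  by rewrite -subr_ge0 (_ : _ - _ = (w - 1) * (w + 1 - 2 * a)); [rewrite mulr_ge0 //; lra|ring].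
case: ltP => [w1|//].
by rewrite -subr_ge0 (_ : _ - _ = (- 1 - w) * (2 * a + 1 - w)); [rewrite mulr_ge0 //; lra|ring].
Qed.

Lemma normr_truncate_le (w : R) : `|truncate w| <= 1.
Proof.
rewrite /truncate; case: ltP => h; first by rewrite normr1.
case: ltP => h'; first by rewrite normrN normr1.
by rewrite ler_norml h h'.
Qed.

Variables (eta p phat : R) (Y M : 'M[R]_n).
Hypotheses (eta_gt0 : 0 < eta) (eta_lt1 : eta < 1).
Hypotheses (p_gt0 : 0 < p) (p_le1 : p <= 1) (n_gt0 : (0 < n)%N).
Hypothesis M_le : forall i j, `|M i j| <= 1.
Hypothesis noise_le : opnorm2_le ((2 + eta / 2) ^+ 2 * (n%:R * p)) (Y - p *: M).
Hypothesis phat_near : (phat - p) ^+ 2 <= (eta / 4) ^+ 2 * p ^+ 2 / n%:R.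
Variables (r : nat) (c : 'I_n -> 'I_r) (h : R).
Hypothesis h_ge0 : 0 <= h.
Hypothesis M_class : forall i j l, c j = c l -> `|M i j - M i l| <= h.

Let nR_gt0 : 0 < n%:R :> R. Proof. by rewrite ltr0n. Qed.
Let np_gt0 : 0 < n%:R * p. Proof. exact: mulr_gt0. Qed.

Let phat_itv : (1 - eta / 4) * p <= phat <= (1 + eta / 4) * p.
Proof.
have : `|phat - p| <= eta / 4 * p.
  rewrite -(ler_pXn2r (ltn0Sn 1)) ?nnegrE // ?mulr_ge0 ?divr_ge0 ?(ltW p_gt0) ?(ltW eta_gt0) //.
  rewrite real_normK ?num_real // exprMn; apply: le_trans phat_near _.
  rewrite ler_pdivrMr //; apply: ler_peMr; last by rewrite ler1n.
  by apply: mulr_ge0; apply: sqr_ge0.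
by rewrite ler_norml => /andP[h1 h2]; apply/andP; split; lra.
Qed.

Let phat_gt0 : 0 < phat.
Proof.
have eta1 := eta_lt1; have /andP[h1 _] := phat_itv; apply: lt_le_trans h1; rewrite mulr_gt0 //; lra.
Qed.

Let r_ge1 : 1 <= r%:R :> R.
Proof. by rewrite ler1n; case: (c (Ordinal n_gt0)) => k; apply: leq_trans. Qed.

(** With a = np, the number of kept singular values is O(r + a h^2), so the thresholded matrix is
    within O(a r + a^2 h^2) of p M in squared norm. Dividing by (n phat)^2, which is of order a^2,
    gives the rate. *)
Lemma usvt_error_le (s : 'I_n -> R) (u v : 'I_n -> 'cV[R]_n) :
  is_svd Y s u v ->
  (n%:R ^+ 2)^-1 * sqnorm (usvt_threshold eta phat s u v - M) <=
  3000 / eta ^+ 2 * (r%:R / (n%:R * p) + h ^+ 2).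
Proof.
have [eta0 eta1 p0 p1] := And4 eta_gt0 eta_lt1 p_gt0 p_le1.
move=> [s0 ou ov YE]; have /andP[ph1 ph2] := phat_itv.
pose S i := (2 + eta) * Num.sqrt (n%:R * phat) <= s i.
have a0 := np_gt0; set a := n%:R * p in a0 *.
pose U := \matrix_(i, j) u i j 0 : 'M[R]_n; pose V := \matrix_(i, j) v i j 0 : 'M[R]_n.
pose Q := class_average R c.
pose t2 := (2 + eta) ^+ 2 * (n%:R * phat); pose d2 := (2 + eta / 2) ^+ 2 * a.
have nphat0 : 0 <= n%:R * phat by rewrite mulr_ge0 ?(ltW phat_gt0) ?(ltW nR_gt0).
have t2E : t2 = ((2 + eta) * Num.sqrt (n%:R * phat)) ^+ 2 by rewrite exprMn sqr_sqrtr.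
have S_ge i : S i -> t2 <= s i ^+ 2.
  move=> Si; rewrite t2E lerXn2r ?nnegrE ?mulr_ge0 ?sqrtr_ge0 //; lra.
have NS_le i : ~~ S i -> s i ^+ 2 <= t2.
  rewrite /S -ltNge => /ltW Si; rewrite t2E lerXn2r ?nnegrE ?mulr_ge0 ?sqrtr_ge0 //; lra.
have YE' : Y = U^T *m (\matrix_(i, j) (s i * V i j)).
  by rewrite YE (sum_rank_one_matrix s u v xpredT).
have UU : U *m U^T = 1%:M by apply: orthonormal_family_matrix.
have VV : V *m V^T = 1%:M by apply: orthonormal_family_matrix.
have d20 : 0 <= d2 by rewrite mulr_ge0 ?sqr_ge0 // ltW.
have t20 : 0 <= t2 by rewrite mulr_ge0 ?sqr_ge0.
have k0 : 0 < eta / 25 by rewrite divr_gt0.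
have D_le := noise_le; rewrite YE' in D_le.
have c1 := card_threshold_le UU VV (class_average_sym R c) (class_average_idem R c)
  (sqnorm_class_average_le R c) t20 d20 k0 D_le S_ge.
have c2 := sqnorm_threshold_le UU VV (class_average_sym R c) (class_average_idem R c)
  (sqnorm_class_average_le R c) t20 d20 D_le NS_le.
set e := sqnorm (p *: M *m (1%:M - class_average R c)) in c1 c2.
set Ah := U^T *m _ in c2.
set N := #|S|%:R in c1 c2.
have N0 : 0 <= N by rewrite ler0n.
have e_le : e <= a ^+ 2 * h ^+ 2.
  have -> : a ^+ 2 * h ^+ 2 = p ^+ 2 * ((n * n)%:R * h ^+ 2) by rewrite /a natrM; ring.
  rewrite /e -scalemxAl sqnormZ; apply: ler_wpM2l; first exact: sqr_ge0.
  exact: sqnorm_class_average_residue_le.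
(* (2 + eta)^2 is at most 9 and [phat] at most 5p/4, which gives 11.25. *)
have t2_le : t2 <= 12 * a.
  have -> : 12 * a = n%:R * (12 * p) by rewrite /a; ring.
  rewrite /t2 mulrCA; apply: ler_wpM2l; first exact: ltW.
  apply: le_trans (_ : 9 * phat <= _); last by nra.
  by apply: ler_wpM2r; [exact: ltW|nra].
have d2_le : d2 <= 25 / 4 * a by apply: ler_wpM2r; [exact: ltW|nra].
(* After [phat] is replaced by its lower bound, the difference divided by [a] is 0.84 eta - 0.33
   eta^2 - 0.26 eta^3. This is at least eta/4 for eta at most 1, with equality at 1; the weight
   eta/25 is fitted to this. *)
have gap : eta / 4 * a <= t2 - (1 + eta / 25) * d2.
  have : (2 + eta) ^+ 2 * ((1 - eta / 4) * a) <= t2.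
    apply: ler_wpM2l; first exact: sqr_ge0.
    have -> : (1 - eta / 4) * a = n%:R * ((1 - eta / 4) * p) by rewrite /a; ring.
    by apply: ler_wpM2l; first exact: ltW.
  move=> h1; apply: le_trans (lerB h1 (lexx _)); rewrite /d2.
  have -> : (2 + eta) ^+ 2 * ((1 - eta / 4) * a) - (1 + eta / 25) * ((2 + eta / 2) ^+ 2 * a) =
    ((2 + eta) ^+ 2 * (1 - eta / 4) - (1 + eta / 25) * (2 + eta / 2) ^+ 2) * a by ring.
  apply: ler_wpM2r; first exact: ltW.
  have : 0 <= eta * (1 - eta) by apply: mulr_ge0; lra.
  have : 0 <= eta ^+ 2 * (1 - eta) by apply: mulr_ge0; [exact: sqr_ge0|lra].
  nra.
have N_le : N * a <= 4 / eta * (12 * (a * r%:R)) + 104 / eta ^+ 2 * (a ^+ 2 * h ^+ 2).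
  have h1 : N * (eta / 4 * a) <= r%:R * (12 * a) + 26 / eta * (a ^+ 2 * h ^+ 2).
    apply: le_trans (ler_wpM2l N0 gap) _; apply: le_trans c1 _; apply: lerD.
      by apply: ler_wpM2l => //; rewrite ler0n.
    apply: le_trans (ler_wpM2l _ e_le) _; first by rewrite addr_ge0 // invr_ge0 ltW.
    apply: ler_wpM2r; first by rewrite mulr_ge0 ?sqr_ge0.
    by rewrite invf_div -lerBrDr -mulrBl (_ : 26 - 25 = 1) ?mul1r ?invf_ge1 // ?ltW //; ring.
  have -> : N * a = 4 / eta * (N * (eta / 4 * a)) by field; rewrite gt_eqF.
  apply: le_trans (ler_wpM2l _ h1) _; first by rewrite divr_ge0 // ltW.
  rewrite le_eqVlt; apply/orP; left; apply/eqP; field; rewrite gt_eqF //.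
have ie1 : 1 <= eta^-1 by rewrite invf_ge1 // ltW.
(* The coefficients are 25/4 times 48 and 104 from the kept values, plus 37 for the rank term and 1
   for [e]. *)
have Ah_le : sqnorm (Ah - p *: M) <= 337 / eta * (a * r%:R) + 651 / eta ^+ 2 * (a ^+ 2 * h ^+ 2).
  apply: le_trans c2 _.
  have h1 : N * d2 <= 25 / 4 * (N * a).
    by rewrite [leRHS]mulrCA; apply: ler_wpM2l.
  have h2 : 2 * (t2 + d2) * r%:R <= 37 * (a * r%:R).
    rewrite [37 * _]mulrA; apply: ler_wpM2r; first by rewrite ler0n.
    lra.
  have ar0 : 0 <= a * r%:R by rewrite mulr_ge0 ?ler0n // ltW.
  have ah0 : 0 <= a ^+ 2 * h ^+ 2 by rewrite mulr_ge0 ?sqr_ge0.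
  have h3 : a * r%:R <= eta^-1 * (a * r%:R) by apply: ler_peMl.
  have h4 : a ^+ 2 * h ^+ 2 <= eta^-1 ^+ 2 * (a ^+ 2 * h ^+ 2).
    by apply: ler_peMl => //; rewrite exprn_ege1.
  rewrite -exprVn in N_le *.
  set z1 := a * r%:R in ar0 h2 h3 N_le *; set z2 := a ^+ 2 * h ^+ 2 in ah0 h4 e_le N_le *.
  have {}N_le : N * a <= 48 * (eta^-1 * z1) + 104 * (eta^-1 ^+ 2 * z2).
    by apply: le_trans N_le _; rewrite -!mulrA; lra.
  rewrite -[337 / eta * z1]mulrA -[651 * _ * z2]mulrA.
  lra.
have W_le : sqnorm (Ah - phat *: M) <= 676 / eta * (a * r%:R) + 1302 / eta ^+ 2 * (a ^+ 2 * h ^+ 2).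
  have -> : Ah - phat *: M = (Ah - p *: M) + (p - phat) *: M.
    by rewrite scalerBl addrA subrK.
  apply: le_trans (sqnormD_le _ _ ltr01) _; rewrite invr1 sqnormZ.
  have M2 : sqnorm M <= n%:R ^+ 2.
    rewrite /sqnorm; apply: le_trans (_ : \sum_(i < n) \sum_(j < n) 1 <= _).
      apply: ler_sum => i _; apply: ler_sum => j _.
      by rewrite -real_normK ?num_real // expr_le1.
    by rewrite !sumr_const !card_ord -mulrnA -natrX mulnn.
  have h1 : (p - phat) ^+ 2 * sqnorm M <= a * r%:R / eta.
    apply: le_trans (_ : ((eta / 4) ^+ 2 * p ^+ 2 / n%:R) * n%:R ^+ 2 <= _).
      apply: ler_pM; rewrite ?sqr_ge0 ?sqnorm_ge0 //.
      by rewrite -sqrrN opprB.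
    have -> : (eta / 4) ^+ 2 * p ^+ 2 / n%:R * n%:R ^+ 2 = (eta / 4) ^+ 2 * (p * a).
      by rewrite /a; field; rewrite gt_eqF.
    apply: le_trans (_ : 1 * (1 * a) <= _).
      apply: ler_pM; rewrite ?sqr_ge0 ?mulr_ge0 ?(ltW p_gt0) ?(ltW a0) //.
        by rewrite expr_le1 ?divr_ge0 ?(ltW eta_gt0) //; lra.
      by apply: ler_wpM2r => //; exact: ltW.
    rewrite !mul1r -mulrA; apply: ler_peMr; first exact: ltW.
    by rewrite -[leLHS]mulr1; apply: ler_pM.
  have -> : 676 / eta * (a * r%:R) = 2 * (337 / eta * (a * r%:R)) + 2 * (a * r%:R / eta) by ring.
  have -> : 1302 / eta ^+ 2 * (a ^+ 2 * h ^+ 2) = 2 * (651 / eta ^+ 2 * (a ^+ 2 * h ^+ 2)) by ring.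
  lra.
have -> : usvt_threshold eta phat s u v - M = phat^-1 *: (Ah - phat *: M).
  rewrite /usvt_threshold gt_eqF // (sum_rank_one_matrix s u v S) scalerBr scalerA.
  by rewrite mulVf ?scale1r // gt_eqF.
rewrite sqnormZ.
(* Since [phat] is at least 3p/4, the factor is 16/9 at most. *)
have ip : phat^-1 ^+ 2 <= 2 / p ^+ 2.
  rewrite exprVn ler_pdivlMr ?exprn_gt0 // mulrC ler_pdivrMr ?exprn_gt0 //.
  apply: le_trans (_ : 2 * ((1 - eta / 4) * p) ^+ 2 <= _); last first.
    by apply: ler_wpM2l => //;
      rewrite lerXn2r ?nnegrE ?mulr_ge0 ?(ltW p_gt0) ?(ltW phat_gt0) //; lra.
  rewrite exprMn mulrA; apply: ler_peMl; first exact: sqr_ge0.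
  nra.
apply: le_trans (_ : (n%:R ^+ 2)^-1 * (2 / p ^+ 2 * (676 / eta * (a * r%:R) +
   1302 / eta ^+ 2 * (a ^+ 2 * h ^+ 2))) <= _).
  apply: ler_wpM2l; first by rewrite invr_ge0 exprn_ge0.
  by apply: ler_pM; rewrite ?sqr_ge0 ?sqnorm_ge0.
have -> : (n%:R ^+ 2)^-1 * (2 / p ^+ 2 * (676 / eta * (a * r%:R) +
   1302 / eta ^+ 2 * (a ^+ 2 * h ^+ 2))) =
   1352 / eta * (r%:R / a) + 2604 / eta ^+ 2 * h ^+ 2.
  by rewrite /a; field; rewrite !gt_eqF.
rewrite mulrDr; apply: lerD.
  apply: ler_wpM2r; first by rewrite divr_ge0 ?ler0n // ltW.
  by rewrite -exprVn; nra.
apply: ler_wpM2r; first exact: sqr_ge0.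
by apply: ler_wpM2r; rewrite ?invr_ge0 ?sqr_ge0 //; lra.
Qed.

End UsvtError.

(** * Mean squared error *)

Section MeanSquareError.
Context d (T : measurableType d) (R : realType) (P : probability T R).

(* The integral of a nonnegative function is a supremum over the simple functions
   below it, which makes the comparison possible although the estimator, given
   only by a relation, may fail to be measurable. *)
Lemma ge0_integral_le_bad_event (f : T -> R) (b C : R) (A : set T) :
  measurable A -> (forall w, 0 <= f w <= C) -> 0 <= b -> 0 <= C ->
  (forall w, ~ A w -> f w <= b) ->
  ('E_P[f] <= b%:E + C%:E * P A)%E.
Proof.
move=> mA fC b0 C0 fb; pose G w := b + C * \1_A w.
have bA : bounded_rv (\1_A : T -> R) by apply: bounded_rv_indic.
have bG : bounded_rv G.
  by apply: bounded_rvD; [exact: bounded_rv_cst|exact: bounded_rvZ].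
have G0 w : 0 <= G w by rewrite addr_ge0 // mulr_ge0 // indicE ler0n.
have fG w : f w <= G w.
  rewrite /G indicE; case: (boolP (w \in A)) => [_|/negP wA].
    by rewrite mulr1; have /andP[_ h] := fC w; rewrite (le_trans h) // lerDr.
  by rewrite mulr0 addr0; apply: fb => Aw; apply: wA; rewrite inE.
rewrite unlock; apply: le_trans (_ : \int[P]_w (G w)%:E <= _)%E.
  rewrite (ge0_integralTE _ (f := fun w => (f w)%:E)) => [|w]; last first.
    by rewrite lee_fin; have /andP[] := fC w.
  rewrite (ge0_integralTE _ (f := fun w => (G w)%:E)) => [|w]; last by rewrite lee_fin.
  apply: ereal_sup_le => _ [h hf <-]; exists h => // w.
  by apply: le_trans (hf w) _; rewrite lee_fin.
rewrite -[X in (X <= _)%E]fineK; last first.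
  by apply: integrable_fin_num => //; apply: bounded_rv_integrable.
rewrite -[fine _]/(Rexp P G) RexpD; [|exact: bounded_rv_cst|exact: bounded_rvZ].
rewrite RexpZ // Rexp_cst Rexp_indic // EFinD EFinM fineK //.
exact: fin_num_measure.
Qed.

Lemma ae_seq_forall (I : eqType) (s : seq I) (Q : I -> T -> Prop) :
  (forall i, {ae P, forall w, Q i w}) -> {ae P, forall w, forall i, i \in s -> Q i w}.
Proof.
move=> hQ; elim: s => [|i s IH]; first by apply: aeW.
apply: filterS2 (hQ i) IH => w Qi Qs j; rewrite in_cons => /orP[/eqP ->//|]; exact: Qs.
Qed.

Variables (m : sampling_model) (n : nat) (M : 'M[R]_n) (p eta : R).
Variables (X : 'I_n -> 'I_n -> {RV P >-> R}) (O : 'I_n -> 'I_n -> {RV P >-> bool}).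
Variable Mhat : T -> 'M[R]_n.
Hypothesis dm : data_model m M p X O.
Hypothesis M_le : forall i j, `|M i j| <= 1.
Hypotheses (p_gt0 : 0 < p) (p_le1 : p <= 1) (n_gt0 : (0 < n)%N).
Hypotheses (eta_gt0 : 0 < eta) (eta_lt1 : eta < 1).
Hypothesis Mhat_usvt : forall w,
  is_usvt m eta (fun i j => X i j w) (fun i j => O i j w) (Mhat w).

Let err (w : T) : R := (n%:R ^+ 2)^-1 * \sum_(i < n) \sum_(j < n) (Mhat w i j - M i j) ^+ 2.

Let n2_gt0 : 0 < n%:R ^+ 2 :> R. Proof. by rewrite exprn_gt0 // ltr0n. Qed.

Let err_itv w : 0 <= err w <= 4.
Proof.
apply/andP; split.
  rewrite /err mulr_ge0 ?invr_ge0 ?(ltW n2_gt0) // sumr_ge0 // => i _.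
  by rewrite sumr_ge0 // => j _; rewrite sqr_ge0.
rewrite /err mulrC ler_pdivrMr //; apply: le_trans (_ : \sum_(i < n) \sum_(j < n) 2 ^+ 2 <= _).
  apply: ler_sum => i _; apply: ler_sum => j _.
  rewrite -real_normK ?num_real // lerXn2r ?nnegrE //.
  apply: le_trans (ler_normB _ _) _; rewrite (_ : 2 = 1 + 1) // lerD //.
  have [s [u [v [_ ->]]]] := Mhat_usvt w; rewrite mxE; exact: normr_truncate_le.
by rewrite !sumr_const !card_ord -mulrnA -[leLHS]mulr_natr -natrX mulnn -natrX.
Qed.

Lemma MSE_le4 : (0 <= MSE P Mhat M <= 4%:E)%E.
Proof.
apply/andP; split; first by apply: expectation_ge0 => w; have /andP[] := err_itv w.
have := @ge0_integral_le_bad_event err 4 4 set0 measurable0 err_itv.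
rewrite measure0 mule0 adde0; apply => // w _; by have /andP[] := err_itv w.
Qed.

(** The deterministic bound holds off three bad events, and the error is at most 4 on them because
    all entries lie in [-1, 1]. The third event, where some entry of the data exceeds 1 in absolute
    value, is null; off it clipping changes nothing. *)
Lemma MSE_le_tail (r : nat) (c : 'I_n -> 'I_r) (h : R) (k : nat) : 0 <= h ->
  (forall i j l, c j = c l -> `|M i j - M i l| <= h) ->
  (MSE P Mhat M <= (3000 / eta ^+ 2 * (r%:R / (n%:R * p) + h ^+ 2) +
    4 * ((2 * n)%:R * (2 * Num.sqrt (n%:R * p) + 2 * ((k.+1).*2).+1%:R ^+ 2) ^+ (k.+1).*2
          / ((2 + eta / 2) ^+ 2 * (n%:R * p)) ^+ k.+1 +
         2 / ((eta / 4) ^+ 2 * (n%:R * p))))%:E)%E.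
Proof.
move=> h0 hc; set K := 3000 / eta ^+ 2.
have K0 : 0 <= K by exact: divr_ge0 (ler0n _ 3000) (sqr_ge0 _).
have np0 : 0 < n%:R * p by rewrite mulr_gt0 // ltr0n.
have tau0 : 0 < (2 + eta / 2) ^+ 2 * (n%:R * p).
  by rewrite mulr_gt0 // exprn_gt0 // addr_gt0 // divr_gt0.
have kap0 : 0 < eta / 4 by rewrite divr_gt0.
have [A1 [mA1 PA1 hA1]] := noise_opnorm_tail dm M_le p_gt0 p_le1 n_gt0 k tau0.
have [A2 [mA2 PA2 hA2]] := observed_proportion_tail dm p_gt0 n_gt0 kap0.
have [A3 [mA3 PA3 hA3]] : {ae P, forall w, forall e, e \in enum {: 'I_n * 'I_n} ->
    `|X e.1 e.2 w| <= 1}.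
  by apply: ae_seq_forall => e; apply: data_bounded dm _ _.
set b1 := (_ / _ ^+ k.+1) in PA1 *; set b2 := 2 / _ in PA2 *.
have b0 : 0 <= K * (r%:R / (n%:R * p) + h ^+ 2).
  apply: mulr_ge0; first exact: K0.
  by rewrite addr_ge0 ?sqr_ge0 // divr_ge0 ?ler0n // ltW.
have mA : measurable (A1 `|` A2 `|` A3) by apply: (measurableU _ _ (measurableU _ _ mA1 mA2) mA3).
apply: le_trans (ge0_integral_le_bad_event (f := err) mA err_itv b0 _ _) _ => [//|w nA|].
  have nA1 : ~ A1 w by move=> Aw; apply: nA; left; left.
  have nA2 : ~ A2 w by move=> Aw; apply: nA; left; right.
  have X1 i j : `|X i j w| <= 1.
    apply: contrapT => nX; apply: nA; right; apply: hA3 => /= /(_ (i, j)) /=.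
    by rewrite mem_enum => /(_ isT).
  have D_le := hA1 w nA1.
  have YE : noise_matrix M p X O w =
      observed_matrix (fun i j => X i j w) (fun i j => O i j w) - p *: M.
    by congr (_ - _); apply/matrixP => i j; rewrite !mxE clip_id.
  rewrite YE in D_le; have [s [u [v [svd MhatE]]]] := Mhat_usvt w.
  have := usvt_error_le eta_gt0 eta_lt1 p_gt0 p_le1 n_gt0 M_le D_le (hA2 w nA2) h0 hc svd.
  apply: le_trans; rewrite /err; apply: ler_wpM2l; first by rewrite invr_ge0 ltW.
  apply: ler_sum => i _; apply: ler_sum => j _.
  rewrite MhatE [map_mx _ _ i j]mxE [in leRHS]mxE [in leRHS](_ : (- M) i j = - M i j) ?mxE //.
  exact: truncate_sqr_le.
rewrite [leRHS]EFinD; apply: leeD2l; rewrite [leRHS]EFinM; apply: lee_wpmul2l;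
  first by rewrite lee_fin.
apply: le_trans (measureU2 P (measurableU _ _ mA1 mA2) mA3) _.
rewrite [X in (_ + X <= _)%E](_ : _ = 0%E) ?adde0; last exact: PA3.
apply: le_trans (measureU2 P mA1 mA2) _.
by rewrite [leRHS]EFinD; apply: leeD.
Qed.

End MeanSquareError.

(** * Choice of the order of the moment *)

Section TailNumerics.
Variable R : realType.

Lemma trace_tail_small (eta eps : R) : 0 < eta -> eta < 1 -> 0 < eps ->
  exists L0 : R, forall (n : nat) (p : R), (0 < n)%N -> 0 < p ->
  expR (eps * ln n%:R) <= n%:R * p -> L0 <= ln n%:R ->
  exists k : nat,
    (2 * n)%:R * (2 * Num.sqrt (n%:R * p) + 2 * ((k.+1).*2).+1%:R ^+ 2) ^+ (k.+1).*2
          / ((2 + eta / 2) ^+ 2 * (n%:R * p)) ^+ k.+1 <= 2 / n%:R.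
Proof.
move=> eta0 eta1 eps0; (* With k close to 10 ln n / eta, this L0 and exp x >= x^3 / 6 give
   2 (2 k + 3)^2 <= (eta / 4) sqrt (n p). *)
exists (1 + 48 * (8 * 23 ^+ 2) / (eta * eps) ^+ 3).
move=> n p n0 p0 np_ge; set L := ln n%:R => L_ge.
have nR0 : 0 < n%:R :> R by rewrite ltr0n.
have np0 : 0 < n%:R * p by rewrite mulr_gt0.
set A := Num.sqrt (n%:R * p).
have A0 : 0 < A by rewrite sqrtr_gt0.
have A2 : A ^+ 2 = n%:R * p by rewrite sqr_sqrtr // ltW.
have ee0 : 0 < (eta * eps) ^+ 3 by rewrite exprn_gt0 // mulr_gt0.
have L1 : 1 <= L.
  apply: le_trans L_ge; rewrite lerDl; apply: divr_ge0; last exact: ltW.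
  by apply: mulr_ge0 => //; apply: mulr_ge0 => //; apply: exprn_ge0.
have L0 : 0 < L by apply: lt_le_trans L1.
exists (Num.truncn (10 * L / eta)); set k := Num.truncn _.
have x0 : 0 <= 10 * L / eta by rewrite divr_ge0 ?mulr_ge0 // ltW.
have /andP[k_le k_gt] := truncn_itv x0; rewrite -/k in k_le k_gt.
have Le1 : 1 <= L / eta by rewrite ler_pdivlMr // mul1r (le_trans (ltW eta1)).
(* The left side is 2k + 3, at most 20 L/eta + 3, and L/eta is at least 1. *)
have K_le : ((k.+1).*2).+1%:R <= 23 * (L / eta).
  rewrite -addn1 natrD -muln2 natrM -natr1.
  have : k%:R <= 10 * (L / eta) by rewrite mulrA.
  lra.
have A_ge : expR (eps * L / 2) <= A.
  rewrite -(ler_pXn2r (ltn0Sn 1)) ?nnegrE ?expR_ge0 ?(ltW A0) // A2.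
  by rewrite -expRM_natr mulfVK // pnatr_eq0.
have A_ge3 : (eps * L / 2) ^+ 3 / 6 <= A.
  apply: le_trans A_ge; have y0 : 0 <= eps * L / 2 by rewrite divr_ge0 ?mulr_ge0 // ltW.
  by apply: le_trans (expR_ge1Dxn 2 y0); rewrite lerDr.
have main : 2 * ((k.+1).*2).+1%:R ^+ 2 <= eta / 4 * A.
  apply: le_trans (_ : 2 * (23 * (L / eta)) ^+ 2 <= _).
    by apply: ler_wpM2l => //; rewrite lerXn2r ?nnegrE ?ler0n // mulr_ge0 // (le_trans _ Le1).
  apply: le_trans (_ : eta / 4 * ((eps * L / 2) ^+ 3 / 6) <= _); last first.
    by apply: ler_wpM2l => //; rewrite divr_ge0 // ltW.
  have h : 48 * (8 * 23 ^+ 2) / (eta * eps) ^+ 3 <= L by apply: le_trans L_ge; rewrite lerDr.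
  have -> : eta / 4 * ((eps * L / 2) ^+ 3 / 6) = (eta * eps ^+ 3 * L ^+ 2 / (4 * 48)) * L by field.
  apply: le_trans (ler_wpM2l _ h); last first.
    by rewrite divr_ge0 ?mulr_ge0 ?exprn_ge0 // ltW.
  rewrite le_eqVlt; apply/orP; left; apply/eqP; field.
  by rewrite !gt_eqF.
have hq : 2 * A + 2 * ((k.+1).*2).+1%:R ^+ 2 <= (1 - eta / 10) * ((2 + eta / 2) * A).
  apply: le_trans (_ : (2 + eta / 4) * A <= _); first by rewrite [leRHS]mulrDl; apply: lerD.
  by rewrite mulrA; apply: ler_wpM2r; [exact: ltW|nra].
rewrite -A2 -exprMn -exprM.
set B := (2 + eta / 2) * A in hq *.
have B0 : 0 < B by rewrite mulr_gt0 // addr_gt0 // divr_gt0.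
set u := 2 * A + _ in hq *.
have u0 : 0 <= u by rewrite addr_ge0 // mulr_ge0 ?sqr_ge0 // ltW.
have uB : u / B <= expR (- (eta / 10)).
  apply: le_trans (_ : 1 - eta / 10 <= _); first by rewrite ler_pdivrMr.
  exact: expR_ge1Dx.
(* The exponent is at least 20 L/eta and each factor at most exp(-eta/10), which gives exp(-2L) =
   n^(-2), enough to beat the 2n in front. *)
have uBq : u ^+ (2 * k.+1) / B ^+ (2 * k.+1) <= n%:R ^- 2.
  rewrite -expr_div_n; apply: le_trans (_ : expR (- (eta / 10)) ^+ (2 * k.+1) <= _).
    by rewrite lerXn2r ?nnegrE ?expR_ge0 // divr_ge0 // ltW.
  have -> : n%:R ^- 2 = expR (- (L * 2)) :> R by rewrite expRN expRM_natr lnK.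
  rewrite -expRM_natr ler_expR natrM mulNr lerN2.
  have : 10 * L / eta <= k.+1%:R by exact: ltW.
  rewrite ler_pdivrMr //; set z := k.+1%:R; lra.
rewrite -mulrA natrM -mul2n; apply: le_trans (ler_wpM2l _ uBq) _; first by rewrite mulr_ge0.
by rewrite -mulrA ler_wpM2l // expr2 invfM mulVKf // gt_eqF.
Qed.

End TailNumerics.

(** * From coverings to the stated rate *)

Lemma covered_classes (R : realType) (K : metricType R) (k n : nat) (delta : R)
    (x : 'I_n -> K) : covered_by_balls K k delta ->
  exists c : 'I_n -> 'I_k, forall j l, c j = c l -> mdist (x j) (x l) <= 2 * delta.
Proof.
move=> [z cov]; have /choice[c hc] : forall i, exists a, ball (z a) delta (x i).
  by move=> i; have [a _ ha] := cov (x i) I; exists a.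
exists c => j l jl; have := hc j; have := hc l; rewrite -jl !ballEmdist /= => hl hj.
apply: le_trans (metric_triangle _ (z (c j)) _) _.
rewrite [2 * _]mulr_natl mulr2n; apply: lerD; last exact: ltW.
by rewrite metric_sym ltW.
Qed.

Lemma distance_matrix_class (R : realType) (K : metricType R) (n : nat) (x : 'I_n -> K) i j l :
  `|distance_matrix x i j - distance_matrix x i l| <= mdist (x j) (x l).
Proof.
rewrite !mxE ler_norml; apply/andP; split.
  by rewrite lerNl opprB lerBlDl; apply: metric_triangle.
by rewrite lerBlDl [mdist (x j) _]metric_sym; apply: metric_triangle.
Qed.

(** If the minimum is 1, the trivial bound 4 suffices. Otherwise delta + a < b with b at most 1, so
    delta and a/b are below 1 and dominate their squares; the rate obtained is the quadratic one,
    which is stronger there. *)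
Lemma rate_le_min (R : realType) (C y delta r n p : R) :
  0 <= C -> 0 < delta -> 0 <= r -> 0 < n -> 0 < p -> p <= 1 -> y <= 4 ->
  y <= C * (r / (n * p) + (delta / 2) ^+ 2) ->
  y <= (C + 4) * Num.min ((delta + Num.sqrt (r / n)) / Num.sqrt p) 1.
Proof.
move=> C0 d0 r0 n0 p0 p1 y4 yC; set a := Num.sqrt (r / n); set b := Num.sqrt p.
have a0 : 0 <= a by apply: sqrtr_ge0.
have b0 : 0 < b by rewrite sqrtr_gt0.
have a2 : a ^+ 2 = r / n by rewrite sqr_sqrtr // divr_ge0 // ltW.
have b2 : b ^+ 2 = p by rewrite sqr_sqrtr // ltW.
have b1 : b <= 1 by rewrite -(ler_pXn2r (ltn0Sn 1)) ?nnegrE ?(ltW b0) // b2 expr1n.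
have h1 : 1 <= b^-1 by rewrite invf_ge1.
case: (lerP 1 ((delta + a) / b)) => [q1|q1].
  by rewrite mulr1; apply: le_trans y4 _; rewrite lerDr.
rewrite ltr_pdivrMr // mul1r in q1.
have e : (delta + a) / b = delta / b + a / b by rewrite mulrDl.
have d1 : delta <= 1 by lra.
have db : delta <= delta / b by apply: ler_peMr => //; exact: ltW.
have h2 : (delta / 2) ^+ 2 <= delta / b.
  apply: le_trans db; rewrite exprMn.
  have : delta ^+ 2 <= delta by rewrite expr2 ger_pMl.
  by have := sqr_ge0 delta; rewrite exprVn; lra.
have h3 : r / (n * p) <= a / b.
  have -> : r / (n * p) = (a / b) ^+ 2 by rewrite exprMn exprVn a2 b2; field; rewrite !gt_eqF.
  have ab0 : 0 <= a / b by rewrite divr_ge0 // ltW.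
  by rewrite expr2 ler_piMl // ler_pdivrMr // mul1r; lra.
rewrite e; apply: le_trans yC _.
apply: le_trans (_ : C * (delta / b + a / b) <= _).
  by apply: ler_wpM2l => //; rewrite addrC lerD.
by apply: ler_wpM2r; rewrite ?lerDl // addr_ge0 // divr_ge0 // ltW.
Qed.

Theorem theorem2p5 (R : realType) (eta : R) (eta_gt0 : 0 < eta)
    (eta_lt1 : eta < 1) :
  exists C c : R, [/\ 0 < C, 0 < c &
    forall eps : R, 0 < eps -> exists Ceps : R,
    forall (K : metricType R) (N : R -> nat) (n : nat) (x : 'I_n -> K) (p : R)
      (m : sampling_model)
      (d : measure_display) (T : measurableType d) (P : probability T R)
      (X : 'I_n -> 'I_n -> {RV P >-> R}) (O : 'I_n -> 'I_n -> {RV P >-> bool})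
      (Mhat : T -> 'M[R]_n),
    compact [set: K] ->
    (forall a b : K, mdist a b <= 1) ->
    (forall delta : R, 0 < delta -> covered_by_balls K (N delta) delta) ->
    (0 < n)%N ->
    0 <= p <= 1 ->
    n%:R `^ (-1 + eps) <= p ->
    data_model m (distance_matrix x) p X O ->
    (forall w : T, is_usvt m eta (fun i j => X i j w) (fun i j => O i j w)
                     (Mhat w)) ->
    (MSE P Mhat (distance_matrix x)
     <= (C * inf [set Num.min ((delta + Num.sqrt ((N (delta / 4))%:R / n%:R))
                               / Num.sqrt p) 1 | delta in [set delta | 0 < delta]%R]
         + Ceps * expR (- c * n%:R * p))%:E)%E].
Proof.
have eta2 : 0 < eta ^+ 2 by rewrite exprn_gt0.
(* 3000/eta^2 comes from the good event; 8 and 128/eta^2 are the coefficients of 1/n and 1/(np) in 4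
   times the probability of the bad event. The 4 added to [K2] below covers the case where the
   minimum is 1. *)
have [K2 K2_ge0 K2E] : exists2 K2 : R, 0 <= K2 &
    K2 = 3000 / eta ^+ 2 + (8 + 128 / eta ^+ 2).
  eexists; last by [].
  apply: addr_ge0; first exact: divr_ge0 (ler0n _ _) (ltW eta2).
  apply: addr_ge0; [exact: ler0n|exact: divr_ge0 (ler0n _ _) (ltW eta2)].
exists (K2 + 4), 1; split=> // [|eps eps0]; first by rewrite ltr_wpDl.
have [L0 hL0] := trace_tail_small eta_gt0 eta_lt1 eps0.
(* If ln n < L0, then np is at most n, hence at most exp(L0), and the exponential term alone is at
   least 4, the trivial bound on the error. *)
exists (4 * expR (expR L0)).
move=> K N n x p m d T P X O Mhat _ diam cov n0 /andP[_ p1] p_ge dm usvt.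
have nR0 : 0 < n%:R :> R by rewrite ltr0n.
have p0 : 0 < p by apply: lt_le_trans p_ge; rewrite powR_gt0.
have M_le i j : `|distance_matrix x i j| <= 1.
  by rewrite mxE ger0_norm ?mdist_ge0.
have /andP[mse0 mse4] := MSE_le4 M_le n0 usvt.
have mse_fin : MSE P Mhat (distance_matrix x) \is a fin_num.
  by rewrite ge0_fin_numE //; apply: le_lt_trans mse4 (ltry _).
rewrite -(fineK mse_fin) in mse4 *; set y := fine _ in mse4 *.
rewrite lee_fin in mse4; rewrite lee_fin.
set S := [set _ | delta in _].
have S0 : S !=set0 by eexists; exists 1 => /=.
have inf_ge0 : 0 <= inf S.
  apply: lb_le_inf => // _ [delta /= delta0 <-].
  by rewrite le_min ler01 andbT divr_ge0 ?addr_ge0 ?sqrtr_ge0 // ltW.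
have [Ln|Ln] := leP L0 (ln n%:R); last first.
  have n_le : n%:R <= expR L0 by rewrite -[leLHS]lnK // ler_expR ltW.
  apply: le_trans mse4 _; apply: le_trans (_ : 4 * expR (expR L0) * expR (- 1 * n%:R * p) <= _).
    rewrite -mulrA -expRD ler_peMr // -[leLHS]expR0 ler_expR.
    rewrite mulN1r mulNr subr_ge0; apply: le_trans n_le.
    by rewrite ler_piMr // ltW.
  by rewrite lerDr mulr_ge0 // addr_ge0.
have np_ge : expR (eps * ln n%:R) <= n%:R * p.
  apply: le_trans (ler_wpM2l (ltW nR0) p_ge).
  rewrite /powR gt_eqF // -[X in _ <= X * _]lnK ?posrE // -expRD ler_expR.
  by rewrite mulrDl mulN1r addrA subrr add0r.
have [k hk] := hL0 n p n0 p0 np_ge Ln.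
apply: le_trans (_ : (K2 + 4) * inf S <= _); last first.
  by rewrite lerDl mulr_ge0 ?expR_ge0 // mulr_ge0 // expR_ge0.
rewrite mulrC -ler_pdivrMr; last by rewrite ltr_wpDl.
apply: lb_le_inf => // _ [delta /= delta0 <-].
rewrite ler_pdivrMr; last by rewrite ltr_wpDl.
rewrite mulrC; apply: rate_le_min => //.
have delta4 : 0 < delta / 4 by rewrite divr_gt0.
have [c hc] := covered_classes x (cov _ delta4).
have r1 : 1 <= (N (delta / 4))%:R :> R.
  by rewrite ler1n; case: (c (Ordinal n0)) => a; apply: leq_trans.
have {}hc j l : c j = c l -> mdist (x j) (x l) <= delta / 2.
  by move=> /hc /le_trans; apply; rewrite (_ : 2 * (delta / 4) = delta / 2) //; field.
have h0 : 0 <= delta / 2 by rewrite divr_ge0 // ltW.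
have := MSE_le_tail dm M_le p0 p1 n0 eta_gt0 eta_lt1 usvt k h0
  (fun i j l jl => le_trans (distance_matrix_class x i j l) (hc j l jl)).
rewrite -(fineK mse_fin) lee_fin -/y => /le_trans; apply.
have np0 : 0 < n%:R * p by rewrite mulr_gt0.
set rho := _ / (n%:R * p) + _.
have rho_ge : (n%:R * p)^-1 <= rho.
  by rewrite ler_wpDr ?sqr_ge0 // ler_peMl // invr_ge0 ltW.
have inv_n_le : n%:R^-1 <= rho.
  by apply: le_trans rho_ge; rewrite invfM ler_peMr ?invr_ge0 ?invf_ge1 // ltW.
rewrite K2E [leRHS]mulrDl; apply: lerD; first exact: lexx.
apply: le_trans (_ : 4 * (2 / n%:R + 2 / ((eta / 4) ^+ 2 * (n%:R * p))) <= _).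
  by apply: ler_wpM2l => //; apply: lerD.
have -> : 4 * (2 / n%:R + 2 / ((eta / 4) ^+ 2 * (n%:R * p))) =
    8 * n%:R^-1 + 128 / eta ^+ 2 * (n%:R * p)^-1 by field; rewrite !gt_eqF.
rewrite [leRHS]mulrDl; apply: lerD; first exact: ler_wpM2l.
by apply: ler_wpM2l rho_ge; apply: divr_ge0 (ler0n _ _) (ltW eta2).
Qed.
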